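(* Let $\alpha>1$, $\rho<0$, and let $(X_i)_{i\ge1}$ be a sequence of i.i.d. real random variables with common distribution function $F$ such that $\overline F=1-F\in2\mathrm{RV}_{-\alpha,\rho}$ with auxiliary function $A$. Let $a_n=F^{\leftarrow}(1-1/n)$ and $Z_n=a_n^{-1}\max(X_1,\dots,X_n)$. If the $X_i$ are continuous random variables (i.e. $F$ is continuous), there exists a constant $C>0$ such that for every $n\ge2$ with $a_n>0$ and $\mathbb E|Z_n|<\infty$, $$\mathrm d_W(Z_n,\mathcal F(\alpha))\le C\Big(\frac1n+|A(a_n)|\Big).$$ If not, then for any $\delta\in(1,\alpha)$ there exists a constant $C_\delta>0$ such that for every $n\ge2$ with $a_n>0$ and $\mathbb E|Z_n|<\infty$, $$\mathrm d_W(Z_n,\mathcal F(\alpha))\le C_\delta\Big(\frac1n+|A(a_n)|\Big)^{1-1/\delta}.$$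
   Context: $\mathcal F(\alpha)$ is the Fréchet distribution, with distribution function $\exp(-x^{-\alpha})$, $x>0$. $F^{\leftarrow}(y)=\inf\{x\in\mathbb R:F(x)\ge y\}$, $y\in(0,1)$. $\mathrm d_W(X,Y)=\sup_h|\mathbb E[h(X)]-\mathbb E[h(Y)]|$, the supremum over all $1$-Lipschitz $h:\mathbb R\to\mathbb R$, is the $1$-Wasserstein distance between the laws of $X$ and $Y$ (random variable and law are identified in the notation). Regular variation: $h\in\mathrm{RV}_\gamma$ means $\lim_{t\to\infty}h(tx)/h(t)=x^\gamma$ for all $x>0$. For $\rho<0$, $h\in 2\mathrm{RV}_{\gamma,\rho}$ with auxiliary function $A$ means that $h\in\mathrm{RV}_\gamma$ and $A$ is an ultimately positive or ultimately negative function such that for all $x>0$, $\lim_{t\to\infty}\frac1{A(t)}\big(\frac{h(tx)}{h(t)}-x^\gamma\big)=x^\gamma\frac{x^\rho-1}{\rho}$. If $\overline F\in2\mathrm{RV}_{-\alpha,\rho}$ with $\rho<0$, then $\overline F(x)=\ell x^{-\alpha}L(x)$ with $\ell>0$, $\lim_{t\to\infty}L(t)=1$ and $|1-L|\in\mathrm{RV}_\rho$; the auxiliary function is taken to be $A(t)=-\rho(1-L(t))/L(t)$. *)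

(* Defs.v *)
From HB Require Import structures.
From mathcomp Require Import all_boot all_order all_algebra finmap.
From mathcomp Require Import all_classical all_reals all_analysis measurable_realfun.

Set Implicit Arguments.
Unset Strict Implicit.
Unset Printing Implicit Defensive.

Import Order.TTheory GRing.Theory Num.Theory.
Import numFieldTopology.Exports numFieldNormedType.Exports.

Local Open Scope classical_set_scope.
Local Open Scope ring_scope.

Definition regularly_varying (R : realType) (gamma : R) (h : R -> R) :=
  forall x, 0 < x -> h (t * x) / h t @[t --> +oo] --> x `^ gamma.

Definition second_order_regularly_varying (R : realType) (gamma rho : R)
    (A h : R -> R) :=
  [/\ regularly_varying gamma h,
      (\forall t \near +oo, 0 < A t) \/ (\forall t \near +oo, A t < 0) &
      forall x, 0 < x ->
        (A t)^-1 * (h (t * x) / h t - x `^ gamma) @[t --> +oo] -->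
          x `^ gamma * ((x `^ rho - 1) / rho)].

(* F^<-; only meaningful for y in ]0, 1[, where the infimum is over a nonempty
   set bounded from below when F is a distribution function *)
Definition quantile (R : realType) (F : R -> R) (y : R) : R :=
  inf [set x | y <= F x].

Definition mutually_independent d (T : measurableType d) (R : realType)
    (P : probability T R) (X : nat -> {RV P >-> R}) :=
  forall (J : {fset nat}) (B : nat -> set R),
    (forall j, measurable (B j)) ->
    P (\bigcap_(j in [set` J]) (X j @^-1` B j)) =
    (\prod_(j <- J) P (X j @^-1` B j))%E.

(* With X 0, X 1, ... standing for X_1, X_2, ..., this is max(X_1, ..., X_n)
   for n >= 1; the default value X 0 t of the iterated maximum only matters
   when n = 0. *)
Definition sample_max (T : Type) (R : realType) (X : nat -> T -> R) (n : nat)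
    (t : T) : R :=
  \big[Num.max/X 0%N t]_(i < n) X i t.

Definition normalized_max d (T : measurableType d) (R : realType)
    (P : probability T R) (X : nat -> {RV P >-> R}) (a : nat -> R) (n : nat)
    (t : T) : R :=
  (a n)^-1 * sample_max X n t.

Section normalized_max_RV.
Context d (T : measurableType d) (R : realType) (P : probability T R).

Lemma measurable_sample_max (X : nat -> {RV P >-> R}) n :
  measurable_fun setT (sample_max X n).
Proof.
suff H (f0 : T -> R) : measurable_fun setT f0 ->
    forall n (Y : nat -> {RV P >-> R}),
    measurable_fun setT (fun t => \big[Num.max/f0 t]_(i < n) Y i t).
  by apply: H; exact: measurable_funPT.
move=> mf0; elim=> [|m IHm] Y.
  by under eq_fun do rewrite big_ord0.
under eq_fun do rewrite big_ord_recl.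
apply: measurable_maxr; first exact: measurable_funPT.
exact: (IHm (fun i => Y i.+1)).
Qed.

Lemma measurable_normalized_max (X : nat -> {RV P >-> R}) (a : nat -> R) n :
  measurable_fun setT (normalized_max X a n).
Proof.
by apply: measurable_funM => //; exact: measurable_sample_max.
Qed.

HB.instance Definition _ (X : nat -> {RV P >-> R}) (a : nat -> R) n :=
  isMeasurableFun.Build _ _ _ _ (normalized_max X a n)
    (measurable_normalized_max X a n).

End normalized_max_RV.

Definition frechet_cdf (R : realType) (alpha x : R) : R :=
  if 0 < x then expR (- x `^ (- alpha)) else 0.

Section frechet.
Context (R : realType) (alpha : R) (alpha_gt0 : 0 < alpha).

Lemma frechet_cdf_nondecreasing : nondecreasing (frechet_cdf alpha).
Proof.
move=> x y xy; rewrite /frechet_cdf; case: ifPn => [x0|_]; last first.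
  by case: ifP => // _; exact: expR_ge0.
have y0 : 0 < y by exact: lt_le_trans xy.
rewrite y0 ler_expR lerN2 !(powRN _ alpha) lef_pV2 ?posrE ?powR_gt0//.
apply: ge0_ler_powR => //; rewrite ?nnegrE; exact: ltW.
Qed.

Let powR_cvgy : x `^ alpha @[x --> +oo] --> +oo.
Proof.
apply/cvgryPge => A; near=> x.
set B := Num.max A 1.
have B0 : 0 <= B by rewrite le_max ler01 orbT.
apply: (@le_trans _ _ B); first by rewrite le_max lexx.
have -> : B = (B `^ alpha^-1) `^ alpha.
  by rewrite -powRrM mulVf ?powRr1// gt_eqF.
have Bx : B `^ alpha^-1 <= x.
  by near: x; apply: nbhs_pinfty_ge; exact: num_real.
apply: ge0_ler_powR => //; rewrite ?nnegrE ?powR_ge0//.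
exact: ltW.
Unshelve. all: by end_near. Qed.

Lemma frechet_cdf_right_continuous : right_continuous (frechet_cdf alpha).
Proof.
move=> a; have [a0|a0|->] := ltgtP a 0.
- rewrite /frechet_cdf [X in _ --> X]ifF; last by rewrite ltNge ltW.
  apply: (@cvg_trans _ (cst 0 @ a^'+)); last exact: cvg_cst.
  apply: near_eq_cvg; near=> x.
  rewrite /= ifF//; apply/negbTE; rewrite -leNgt.
  by near: x; exact: nbhs_right_le.
- rewrite /frechet_cdf a0.
  apply: (@cvg_trans _ (expR (- x `^ (- alpha)) @[x --> a^'+])).
    apply: near_eq_cvg; near=> x.
    by rewrite /= ifT// (lt_trans a0).
  apply: cvg_at_right_filter.
  apply: (@continuous_cvg _ _ _ _ _ _ expR); first exact: continuous_expR.
  apply: cvgN.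
  have /derivable1_diffP/differentiable_continuous :
      derivable (fun x => x `^ (- alpha)) a 1.
    by apply: derivable_powR; rewrite in_itv/= a0.
  exact.
- rewrite [X in _ --> X](_ : _ = 0); last by rewrite /frechet_cdf ltxx.
  apply: (@cvg_trans _ (expR (- (x `^ alpha)^-1) @[x --> 0^'+])).
    apply: near_eq_cvg; near=> x.
    by rewrite /frechet_cdf ifT// powRN.
  apply: (@cvg_comp _ _ _ (fun x : R => (x `^ alpha)^-1) (fun x => expR (- x))).
    apply/cvgrVy; last exact: powR_cvg0.
    by near=> x; rewrite powR_gt0.
  exact: cvgr_expR.
Unshelve. all: by end_near. Qed.

Lemma frechet_cdf_Ny : frechet_cdf alpha @ -oo --> (0 : R).
Proof.
apply: (@cvg_trans _ (cst 0 @ -oo)); last exact: cvg_cst.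
apply: near_eq_cvg; near=> x.
by rewrite /frechet_cdf ltNge (_ : x <= 0).
Unshelve. all: by end_near. Qed.

Lemma frechet_cdf_y : frechet_cdf alpha @ +oo --> (1 : R).
Proof.
apply: (@cvg_trans _ (expR (- (x `^ alpha)^-1) @[x --> +oo])).
  apply: near_eq_cvg; near=> x.
  by rewrite /frechet_cdf ifT// powRN.
rewrite -(@expR0 R) -[in expR 0]oppr0.
apply: (@continuous_cvg _ _ _ _ _ _ expR); first exact: continuous_expR.
apply: cvgN; apply/gtr0_cvgV0 => //.
by near=> x; rewrite powR_gt0.
Unshelve. all: by end_near. Qed.

Definition frechet_cumulative : cumulativeBounded (0 : R) (1 : R) :=
  HB.pack (frechet_cdf alpha)
    (isCumulative.Build R _ R (frechet_cdf alpha)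
      frechet_cdf_nondecreasing frechet_cdf_right_continuous)
    (isCumulativeBounded.Build R 0 1 (frechet_cdf alpha)
      frechet_cdf_Ny frechet_cdf_y).

(* lebesgue_stieltjes_measure lives on measurableTypeR R, and is
   viewed here as a measure on R itself. *)
Definition frechet (B : set R) : \bar R :=
  lebesgue_stieltjes_measure frechet_cumulative B.

Let mu : {measure set (measurableTypeR R) -> \bar R} :=
  lebesgue_stieltjes_measure frechet_cumulative.

Let frechet0 : frechet set0 = 0%E.
Proof. exact: (measure0 mu). Qed.

Let frechet_ge0 B : (0 <= frechet B)%E.
Proof. exact: (measure_ge0 mu). Qed.

Let frechet_sigma_additive :
  semi_sigma_additive (frechet : set (R : measurableType _) -> \bar R).
Proof. exact: (@measure_semi_sigma_additive _ _ _ mu). Qed.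

HB.instance Definition _ := isMeasure.Build _ R _ frechet
  frechet0 frechet_ge0 frechet_sigma_additive.

Let frechet_setT : frechet setT = 1%E.
Proof.
exact: (@probability_setT _ _ _ (lebesgue_stieltjes_measure frechet_cumulative)).
Qed.

HB.instance Definition _ := Measure_isProbability.Build _ R _
  frechet frechet_setT.

Lemma frechet_itvNy x : frechet `]-oo, x] = (frechet_cdf alpha x)%:E.
Proof. by rewrite -[RHS](cdf_lebesgue_stieltjes_id frechet_cumulative). Qed.

End frechet.

(* The 1-Wasserstein distance between two laws on R; the expectations are real
   numbers as soon as both laws have a finite first moment. *)
Definition wasserstein1 (R : realType) (mu nu : probability R R) : \bar R :=
  ereal_sup [set `|'E_mu[h] - 'E_nu[h]|%E | h in [set h | 1.-lipschitz h]].

(* Main.v *)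
(* By the quantile coupling on ]0, 1[ and Tonelli's theorem, the Wasserstein
   distance is at most the integral of |F(a_n x)^n - exp(-x^-alpha)|.  Put
   D = |1 - L|, which is regularly varying of index rho since A is proportional
   to (1 - L) / L; the uniform convergence theorem gives the Potter bounds
   D s <= K D t and D t <= K (s/t)^(2|rho|) D s for t <= s.  As
   n (1 - F(a_n)) = 1 + O(D(a_n)), even when F jumps at a_n, the number
   y = n (1 - F(a_n x)) differs from z = x^-alpha by at most
   C D(a_n) z (1 + z^k), and comparing (1 - y/n)^n with exp(-z) yields, for
   x > 0, the error C (1/n + D(a_n)) min(1, z), which is integrable because
   alpha > 1.  For x < 0, F(a_n x)^n is exponentially small compared with the
   integrable F(a_m x)^m, where m is a fixed index with E|Z_m| finite.  The rate
   1/n + |A(a_n)| therefore holds without continuity, and it is dominated by its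
   power 1 - 1/delta once it is at most 1. *)
Require Import Defs.
From HB Require Import structures.
From mathcomp Require Import all_boot all_order all_algebra finmap.
From mathcomp Require Import all_classical all_reals all_analysis.
From mathcomp Require Import measurable_realfun ring lra.

Set Implicit Arguments.
Unset Strict Implicit.
Unset Printing Implicit Defensive.

Import Order.TTheory GRing.Theory Num.Theory.
Import numFieldTopology.Exports numFieldNormedType.Exports.

Local Open Scope classical_set_scope.
Local Open Scope ring_scope.

(** * Quantile coupling *)

Lemma measurable_sigma_itvNyc (R : realType) :
  @measurable _ R = <<s [set A : set R | exists x, A = `]-oo, x]%classic] >>.
Proof.
apply/seteqP; split; last first.
  apply: smallest_sub; first exact: sigma_algebra_measurable.
  by move=> _ [x ->]; exact: measurable_itv.
have -> : (@measurable _ R) = <<s @RGenOInfty.G R >>.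
  exact: RGenOInfty.measurableE.
apply: smallest_sub; first exact: smallest_sigma_algebra.
move=> _ [x ->]; rewrite -setCitvl.
rewrite -setTD; apply: sigma_algebraCD.
by apply: sub_sigma_algebra; exists x.
Qed.

(** The half-lines form a generating family stable under intersection, and those ending at [n]
    exhaust the line with finite mass. *)
Lemma measure_eq_itvNyc (R : realType) (m1 m2 : {measure set R -> \bar R}) :
  (forall x, m1 `]-oo, x]%classic = m2 `]-oo, x]%classic) -> (m1 setT < +oo)%E ->
  forall B, measurable B -> m1 B = m2 B.
Proof.
move=> m12 m1oo B mB.
pose G := [set A : set R | exists x, A = `]-oo, x]%classic].
apply: (@measure_unique _ _ _ G (fun n => `]-oo, n%:R]%classic)) => //.
- exact: measurable_sigma_itvNyc.
- move=> _ _ [x ->] [y ->]; exists (Num.min x y).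
  by apply/seteqP; split => z /=; rewrite !in_itv/= le_min => /andP.
- by move=> n; exists n%:R.
- rewrite -subTset => x _; exists (Num.truncn x).+1 => //=.
  by rewrite in_itv/= ltW// truncnS_gt.
- by move=> _ [x ->].
- move=> n; apply: le_lt_trans m1oo; apply: le_measure; rewrite ?inE//.
Qed.

(** [|f t - g t|] is the length of the set of levels [x] that separate [f t] from [g t], which the
    exclusive or expresses; Tonelli's theorem then exchanges [t] and [x]. *)
Lemma integral_abs_sub d (T : measurableType d) (R : realType)
    (m : {sigma_finite_measure set T -> \bar R}) (f g : T -> R) :
  measurable_fun setT f -> measurable_fun setT g ->
  (\int[m]_t (`|f t - g t|%R)%:E =
   \int[lebesgue_measure]_x m [set t | (f t <= x)%R (+) (g t <= x)%R])%E.
Proof.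
move=> mf mg.
pose S : set (T * measurableTypeR R) := [set p | (f p.1 <= p.2) (+) (g p.1 <= p.2)].
have mS : measurable S.
  have mfp : measurable_fun setT (fun p : T * measurableTypeR R => f p.1 <= p.2).
    by apply: measurable_fun_ler => //; exact: measurableT_comp.
  have mgp : measurable_fun setT (fun p : T * measurableTypeR R => g p.1 <= p.2).
    by apply: measurable_fun_ler => //; exact: measurableT_comp.
  pose Sf := (fun p : T * measurableTypeR R => f p.1 <= p.2) @^-1` [set true].
  pose Sg := (fun p : T * measurableTypeR R => g p.1 <= p.2) @^-1` [set true].
  have mSf : measurable Sf by rewrite -[Sf]setTI; exact: mfp.
  have mSg : measurable Sg by rewrite -[Sg]setTI; exact: mgp.
  rewrite (_ : S = (Sf `\` Sg) `|` (Sg `\` Sf)).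
    by apply: measurableU; exact: measurableD.
  apply/seteqP; split => p; rewrite /S /Sf /Sg /=;
    case: (_ <= _); case: (_ <= _) => //=; try by [left|right];
    by case=> // -[].
have := @indic_fubini_tonelli _ _ T (measurableTypeR R) R m lebesgue_measure S mS.
rewrite indic_fubini_tonelli_FE// indic_fubini_tonelli_GE// => mE.
rewrite [RHS](_ : _ = (\int[lebesgue_measure]_x m (ysection S x))%E); last first.
  apply: eq_integral => x _; congr (m _); apply/seteqP; split => t /=.
    by move=> h; rewrite /ysection/= inE.
  by rewrite /ysection/= inE.
rewrite -[RHS]mE; apply: eq_integral => t _ /=.
have Sitv (a b : R) : a <= b ->
    [set x : R | (a <= x) (+) (b <= x)] = `[a, b[%classic.
  move=> ab; apply/seteqP; split => x /=; rewrite in_itv/=.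
    by rewrite ltNge; have [|] := leP b x; have [|] := leP a x => // xa bx;
      move: (lt_le_trans xa (le_trans ab bx)); rewrite ltxx.
  by move=> /andP[-> xb] /=; rewrite leNgt xb.
have -> : xsection S t = [set x | (f t <= x) (+) (g t <= x)].
  by rewrite /xsection; apply/seteqP; split => x /=; rewrite inE.
have [fg|gf] := leP (f t) (g t).
  rewrite Sitv// lebesgue_measure_itv/= lte_fin.
  have [fg'|] := ltP (f t) (g t).
    by rewrite EFinN -EFinB ler0_norm ?subr_le0// opprB.
  move=> gf; have -> : f t = g t by apply/eqP; rewrite eq_le fg.
  by rewrite subrr normr0.
rewrite (_ : [set x | _] = [set x | (g t <= x) (+) (f t <= x)]); last first.
  by apply/seteqP; split => x /=; rewrite addbC.
rewrite Sitv ?ltW// lebesgue_measure_itv/= lte_fin gf.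
by rewrite EFinN -EFinB ger0_norm// subr_ge0 ltW.
Qed.

Lemma lipschitz1_continuous (R : realType) (h : R -> R) :
  1.-lipschitz h -> continuous h.
Proof.
move=> hlip x; apply/cvgrPdist_le => e e0; near=> y.
apply: (@le_trans _ _ `|x - y|); last first.
  by near: y; apply: cvgr_dist_le.
by have := hlip (x, y) (conj I I); rewrite /= mul1r.
Unshelve. all: by end_near. Qed.

(** Agreement on half-lines makes [mu] the pushforward of [m] by [p]. The nonnegative version
    transfers the first moment, the integrable one the test functions. *)
Lemma integral_eq_law d (T : measurableType d) (R : realType)
    (m : {finite_measure set T -> \bar R}) (p : T -> R)
    (mu : probability R R) :
  measurable_fun setT p ->
  (forall x, m (p @^-1` `]-oo, x]) = mu `]-oo, x]%classic) ->
  (forall f : R -> \bar R, measurable_fun setT f -> (forall x, 0 <= f x)%E ->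
    \int[mu]_x f x = \int[m]_t f (p t))%E /\
  (forall f : R -> \bar R, measurable_fun setT f ->
    m.-integrable setT (f \o p) ->
    \int[mu]_x f x = \int[m]_t f (p t))%E.
Proof.
move=> mp law.
have lawB : forall B : set R, measurable B -> pushforward m p B = mu B.
  move=> B mB; apply: (@measure_eq_itvNyc _ (pushforward m p)) => //.
  by rewrite /= /pushforward ltey_eq fin_num_measure// preimage_setT.
have E (f : R -> \bar R) : (\int[mu]_x f x = \int[pushforward m p]_x f x)%E.
  by apply: eq_measure_integral => B mB _; exact/esym/lawB.
split=> f mf; [move=> f0|move=> intf]; rewrite E.
  by rewrite ge0_integral_pushforward.
by rewrite integral_pushforward.
Qed.

(** A 1-Lipschitz function changes by at most [|p - q|] between the two coordinates of the coupling.
    When the cost is finite, [q = p - (p - q)] is integrable along with [p], so the two expectations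
    can be subtracted under one integral. *)
Lemma wasserstein1_coupling d (T : measurableType d) (R : realType)
    (m : {finite_measure set T -> \bar R}) (p q : T -> R)
    (mu nu : probability R R) :
  measurable_fun setT p -> measurable_fun setT q ->
  (forall x, m (p @^-1` `]-oo, x]) = mu `]-oo, x]%classic) ->
  (forall x, m (q @^-1` `]-oo, x]) = nu `]-oo, x]%classic) ->
  (\int[mu]_x (`|x|%R)%:E < +oo)%E ->
  (wasserstein1 mu nu <= \int[m]_t (`|p t - q t|%R)%:E)%E.
Proof.
move=> mp mq lawp lawq mu_int.
have [pq_oo|pq_oo] := ltP (\int[m]_t (`|p t - q t|%R)%:E)%E +oo%E; last first.
  by apply: le_trans pq_oo; rewrite leey.
have mpq : measurable_fun setT (fun t => p t - q t) by exact: measurable_funB.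
have ipq : m.-integrable setT (fun t => (p t - q t)%:E).
  by apply/integrableP; split => //; exact/measurable_EFinP.
have ip : m.-integrable setT (fun t => (p t)%:E).
  apply/integrableP; split; first exact/measurable_EFinP.
  move: mu_int; rewrite (integral_eq_law mp lawp).1//.
  by apply/measurable_EFinP; exact: (@normr_measurable R setT).
have iq : m.-integrable setT (fun t => (q t)%:E).
  apply: (eq_integrable _ ((fun t => (p t)%:E) \- (fun t => (p t - q t)%:E))%E) => //.
    by move=> t _ /=; rewrite -EFinB subKr.
  exact: integrableB.
apply: ge_ereal_sup => _ [h hlip <-].
have mh : measurable_fun setT h.
  by apply: continuous_measurable_fun; exact: lipschitz1_continuous.
have hB x y : `|h x - h y| <= `|x - y|.
  by have := hlip (x, y) (conj I I); rewrite /= mul1r.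
have ih r : measurable_fun setT r -> m.-integrable setT (fun t => (r t)%:E) ->
    m.-integrable setT (fun t => (h (r t))%:E).
  move=> mr ir.
  (* A Lipschitz function grows at most linearly, and constants are integrable because [m] is
     finite. *)
  have ir1 : m.-integrable setT (fun t => (`|r t| + `|h 0|)%:E).
    under eq_fun do rewrite EFinD.
    apply: integrableD => //; first exact: (integrable_abse ir).
    exact: finite_measure_integrable_cst.
  apply: (le_integrable _ _ _ ir1) => //.
    by apply/measurable_EFinP; exact: measurableT_comp.
  move=> t _; rewrite lee_fin [leRHS]ger0_norm; last by rewrite addr_ge0.
  rewrite -[h (r t)](subrK (h 0)); apply: (le_trans (ler_normD _ _)).
  by rewrite lerD2r; apply: (le_trans (hB _ _)); rewrite subr0.
rewrite !unlock.
rewrite (integral_eq_law mp lawp).2//; last 2 first.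
  exact/measurable_EFinP.
  exact: ih.
rewrite (integral_eq_law mq lawq).2//; last 2 first.
  exact/measurable_EFinP.
  exact: ih.
rewrite -integralB//; [|exact: ih..].
apply: (le_trans (le_abse_integral _ _ _)) => //.
  by apply/measurable_EFinP; apply: measurable_funB; exact: measurableT_comp.
apply: ge0_le_integral => //.
- apply/measurable_EFinP; apply: measurableT_comp => //.
  by apply: measurable_funB; exact: measurableT_comp.
- by apply/measurable_EFinP; exact: measurableT_comp.
- by move=> t _; rewrite -EFinB/= lee_fin.
Qed.

Lemma cdfP d (T : measurableType d) (R : realType) (P : probability T R)
    (X : {RV P >-> R}) (F : R -> R) :
  (forall x, cdf X x = (F x)%:E) ->
  [/\ nondecreasing F, right_continuous F,
      F x @[x --> -oo] --> (0 : R) & F x @[x --> +oo] --> (1 : R)].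
Proof.
move=> XF.
have FE : F = fine \o cdf X by apply/funext => x /=; rewrite XF.
split.
- by move=> x y xy; rewrite -lee_fin -!XF; exact: cdf_nondecreasing.
- move=> a; rewrite FE; apply: fine_cvg => /=.
  by rewrite XF/= -XF; exact: cdf_right_continuous.
- by rewrite FE; apply: fine_cvg; exact: cvg_cdfNy0.
- by rewrite FE; apply: fine_cvg; exact: cvg_cdfy1.
Qed.

Lemma probability_itvNyP (R : realType) (mu : probability R R) (F : R -> R) :
  (forall x, mu `]-oo, x]%classic = (F x)%:E) ->
  [/\ nondecreasing F, right_continuous F,
      F x @[x --> -oo] --> (0 : R) & F x @[x --> +oo] --> (1 : R)].
Proof.
move=> muF.
pose idR : R -> R := idfun.
have mid : measurable_fun setT idR by exact: measurable_id.
pose X : {RV mu >-> R} := HB.pack idR (isMeasurableFun.Build _ _ _ _ idR mid).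
by apply: (@cdfP _ _ _ mu X) => x; rewrite -muF.
Qed.

(** The limits at both ends make the defining set nonempty and bounded below, and right continuity
    makes its infimum attained. *)
Lemma quantile_le (R : realType) (F : R -> R) (u x : R) :
  nondecreasing F -> right_continuous F ->
  F x @[x --> -oo] --> (0 : R) -> F x @[x --> +oo] --> (1 : R) ->
  0 < u < 1 -> (quantile F u <= x) = (u <= F x).
Proof.
move=> ndF rcF F0 F1 /andP[u0 u1].
have S0 : [set y | u <= F y] !=set0.
  near (@pinfty_nbhs R) => y; exists y => /=; apply/ltW.
  by near: y; apply: (cvgr_gt _ F1).
have Slb : has_lbound [set y | u <= F y].
  near (@ninfty_nbhs R) => z; exists z => y /= uy; rewrite leNgt; apply/negP => yz.
  have : F z < u by near: z; apply: (cvgr_lt _ F0).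
  by rewrite ltNge (le_trans uy)// ndF// ltW.
apply/idP/idP => [qx|ux]; last exact: ge_inf.
apply: (@le_trans _ _ (F (quantile F u))); last exact: ndF.
(* If [F] were below [u] at the quantile, it would still be so at some [y] further right, although
   the infimum leaves a point of the set before [y]. *)
rewrite leNgt; apply/negP => Fq.
near (quantile F u)^'+ => y.
have : F y < u by near: y; apply: (cvgr_lt _ (rcF _)).
apply/negP; rewrite -leNgt.
have qy : quantile F u < y by near: y; exact: nbhs_right_gt.
have [s /= us sy] := inf_lt S0 qy.
by rewrite (le_trans us)// ndF// ltW.
Unshelve. all: by end_near. Qed.

(** The two quantile functions are coupled on ]0, 1[. A level [x] separates the quantiles at [u]
    exactly when [u] separates [F x] from [G x], and such [u] fill an interval of length
    [|F x - G x|]. *)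
Lemma wasserstein1_le_cdf (R : realType) (mu nu : probability R R)
    (F G : R -> R) :
  (forall x, mu `]-oo, x]%classic = (F x)%:E) ->
  (forall x, nu `]-oo, x]%classic = (G x)%:E) ->
  (\int[mu]_x (`|x|%R)%:E < +oo)%E ->
  (wasserstein1 mu nu <= \int[lebesgue_measure]_x (`|F x - G x|%R)%:E)%E.
Proof.
move=> muF nuG mu_int.
pose I01 : set R := `]0, 1[%classic.
have I01E u : I01 u = (0 < u < 1) by rewrite /I01/= in_itv.
have mI : measurable (I01 : set (measurableTypeR R)) by exact: measurable_itv.
have I1 : (lebesgue_measure I01 = 1)%E.
  by rewrite lebesgue_measure_itv/= lte_fin ltr01 oppr0 adde0.
have Ioo : (lebesgue_measure I01 < +oo)%E by rewrite I1 ltry.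
(* Lebesgue measure restricted to ]0, 1[ is a finite measure on the whole line; the value 0 given to
   [q] outside ]0, 1[ carries no mass. *)
pose m := @mfrestr _ (measurableTypeR R) R I01 lebesgue_measure mI Ioo.
pose q (H : R -> R) (u : R) := if 0 < u < 1 then quantile H u else 0.
have qP (la : probability R R) (H : R -> R) :
    (forall x, la `]-oo, x]%classic = (H x)%:E) ->
  [/\ measurable_fun setT (q H),
      (forall u x, 0 < u < 1 -> (q H u <= x) = (u <= H x)) &
      (forall x, m (q H @^-1` `]-oo, x]) = la `]-oo, x]%classic)].
  move=> laH; have [ndH rcH H0 H1] := probability_itvNyP laH.
  have qE u x : 0 < u < 1 -> (q H u <= x) = (u <= H x).
    by move=> u01; rewrite /q u01 quantile_le.
  have H01 x : 0 <= H x <= 1.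
    rewrite -!lee_fin -laH measure_ge0/=; exact: probability_le1.
  have qpre x : q H @^-1` `]-oo, x] =
      (I01 `&` `]-oo, H x]) `|` (~` I01 `&` [set _ | 0 <= x]).
    apply/seteqP; split => u /=; rewrite !in_itv/= I01E.
      have [u01|/negbTE u01] := boolP (0 < u < 1).
        by rewrite qE// => ?; left.
      by rewrite /q u01 => ?; right.
    case=> [[u01 ?]|[/negP/negbTE u01 x0]]; first by rewrite qE.
    by rewrite /q u01.
  split => //.
    apply: (measurability _ (measurable_sigma_itvNyc R)) => _ [_ [x ->] <-].
    rewrite setTI qpre; apply: measurableU.
      by apply: measurableI => //; exact: measurable_itv.
    have [x0|x0] := leP 0 x.
      by rewrite (_ : [set _ | _] = setT) ?setIT; [exact: measurableC|apply/seteqP; split].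
    by rewrite (_ : [set _ | _] = set0) ?setI0//; apply/seteqP; split.
  move=> x; rewrite laH /m /mfrestr /mrestr qpre setIUl -setIA (setIC _ I01).
  rewrite setIA setIid -setIA (setIC _ I01) setIA setICl set0I setU0.
  have /andP[Hx0 Hx1] := H01 x.
  (* When [H x = 1] the right endpoint lies outside ]0, 1[ and has to be dropped. *)
  rewrite (_ : _ `&` _ = if H x < 1 then `]0, H x]%classic else `]0, 1[%classic); last first.
    apply/seteqP; split => u /=; case: ifPn => Hx /=; rewrite !in_itv/= I01E.
    - by move=> [/andP[-> _] ->].
    - by move=> [].
    - by move=> /andP[u0 ux]; rewrite u0 ux (le_lt_trans ux).
    - move=> /andP[u0 u1]; rewrite u0 u1; split => //.
      by rewrite (le_trans (ltW u1))// leNgt.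
  case: ifPn => Hx; rewrite lebesgue_measure_itv/= lte_fin.
    have [_|Hx0'] := ltP; first by rewrite oppr0 adde0.
    by congr (_%:E); apply/eqP; rewrite eq_le Hx0 Hx0'.
  by rewrite ltr01 oppr0 adde0; congr (_%:E); apply/eqP; rewrite eq_le Hx1 leNgt Hx.
have [mqF qFE lawF] := qP mu F muF.
have [mqG qGE lawG] := qP nu G nuG.
apply: (le_trans (@wasserstein1_coupling _ _ _ m (q F) (q G) mu nu
  mqF mqG lawF lawG mu_int)).
rewrite integral_abs_sub//.
have [ndF _ _ _] := probability_itvNyP muF.
have [ndG _ _ _] := probability_itvNyP nuG.
have xorE (a b : R) : 0 <= a -> a <= b -> b <= 1 ->
    lebesgue_measure ([set u : R | (u <= a) (+) (u <= b)] `&` I01) = (b - a)%:E.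
  move=> a0 ab b1.
  rewrite (_ : _ `&` _ = if b < 1 then `]a, b]%classic else `]a, 1[%classic).
    case: ifPn => bn; rewrite lebesgue_measure_itv/= lte_fin.
      have [_|ba] := ltP; first by rewrite EFinN -EFinB.
      by rewrite (_ : b = a) ?subrr//; apply/eqP; rewrite eq_le ab ba.
    have -> : b = 1 by apply/eqP; rewrite eq_le b1 leNgt.
    have [_|a1] := ltP; first by rewrite EFinN -EFinB.
    by rewrite (_ : a = 1) ?subrr//; apply/eqP; rewrite eq_le a1 (le_trans ab).
  apply/seteqP; split => u; case: ifPn => bn /=; rewrite !in_itv/= I01E.
  - have [ua|au] := leP u a; first by rewrite (le_trans ua ab) => -[].
    by rewrite /= => -[->].
  - have [ua|au] := leP u a; first by rewrite (le_trans ua ab) => -[].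
    by case=> _ /andP[].
  - move=> /andP[au ub]; rewrite leNgt au ub/= (le_lt_trans a0 au).
    by rewrite (le_lt_trans ub).
  - move=> /andP[au u1]; rewrite leNgt au u1/= (le_lt_trans a0 au).
    by rewrite (le_trans (ltW u1))// leNgt.
rewrite le_eqVlt; apply/orP; left; apply/eqP; apply: eq_integral => x _.
have HB01 (la : probability R R) (H : R -> R) :
    (forall x, la `]-oo, x]%classic = (H x)%:E) -> 0 <= H x <= 1.
  by move=> laH; rewrite -!lee_fin -laH measure_ge0/=; exact: probability_le1.
have /andP[F0 F1] := HB01 mu F muF; have /andP[G0 G1] := HB01 nu G nuG.
transitivity (lebesgue_measure ([set u : R | (u <= F x) (+) (u <= G x)] `&` I01)).
  rewrite /m/= /mfrestr /mrestr; congr lebesgue_measure.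
  by apply/seteqP; split => u /= []; rewrite I01E => + u01; rewrite !(qFE,qGE).
have [FG|GF] := leP (F x) (G x).
  by rewrite xorE// ler0_norm ?opprB// subr_le0.
rewrite (_ : [set u | _] = [set u : R | (u <= G x) (+) (u <= F x)]).
  by rewrite xorE ?(ltW GF)// ger0_norm// subr_ge0 ltW.
by apply/seteqP; split => u /=; rewrite addbC.
Qed.

(** The indicator of [0 <= x] is the distribution function of the constant 0, so this is
    [integral_abs_sub] against that constant. *)
Lemma integral_abs_cdf d (T : measurableType d) (R : realType)
    (P : probability T R) (Z : {RV P >-> R}) (H : R -> R) :
  (forall x, cdf Z x = (H x)%:E) ->
  (\int[P]_t (`|Z t|%R)%:E =
   \int[lebesgue_measure]_x (`|H x - (0 <= x)%R%:R|%R)%:E)%E.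
Proof.
move=> ZH.
have := @integral_abs_sub _ T R P Z (cst 0) _ _.
under eq_integral do rewrite subr0.
move=> -> //; apply: eq_integral => x _ /=.
have H01 : 0 <= H x <= 1.
  by rewrite -!lee_fin -ZH cdf_ge0/=; exact: cdf_le1.
have /andP[H0 H1] := H01.
have ZE : [set t | Z t <= x] = Z @^-1` `]-oo, x].
  by apply/seteqP; split => t /=; rewrite in_itv.
have PE : P [set t | Z t <= x] = (H x)%:E by rewrite -ZH ZE.
have [x0|x0] := leP 0 x.
  rewrite (_ : [set t | _] = ~` [set t | Z t <= x]); last first.
    by apply/seteqP; split => t /=; case: (Z t <= x).
  rewrite probability_setC ?PE; last by rewrite ZE; exact: measurable_funPTI.
  by rewrite -EFinB ler0_norm ?opprB// subr_le0.
rewrite (_ : [set t | _] = [set t | Z t <= x]); last first.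
  by apply/seteqP; split => t /=; rewrite addbF.
by rewrite PE subr0 ger0_norm.
Qed.

(** * Regular variation *)

Lemma lebesgue_measure_shift (R : realType) (c : R) (B : set R) :
  measurable B -> lebesgue_measure ((fun x => x + c) @^-1` B) = lebesgue_measure B.
Proof.
move=> mB.
have mc : measurable_fun (setT : set (measurableTypeR R))
    ((fun x : R => x + c) : measurableTypeR R -> measurableTypeR R).
  by apply: measurable_funD.
pose X : {mfun (measurableTypeR R) >-> (measurableTypeR R)} :=
  HB.pack ((fun x : R => x + c) : measurableTypeR R -> measurableTypeR R)
    (isMeasurableFun.Build _ _ _ _ _ mc).
apply/esym; rewrite (@lebesgue_measure_unique _ (pushforward lebesgue_measure X))//.
move=> _ [[a b] _ <-]; rewrite /= /pushforward.
rewrite (_ : X @^-1` _ = `]a - c, b - c]%classic).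
  rewrite !lebesgue_measure_itv/= !lte_fin ltrD2r; case: ifPn => // _.
  by congr (_%:E); ring.
by apply/seteqP; split => x /=; rewrite !in_itv/= ltrBlDr lerBrDr.
Qed.

(* Along u_n -> oo and v_n in [0, 1], the points x of [0, 3] where
   g (u_m + x) is within 1 of g (u_m) for all m >= n fill it up as n grows, and
   likewise for u_m + v_m.  Two such sets of measure > 2 must meet inside [0, 4]
   once the second one is shifted by v_n. *)
Lemma slowly_varying_bounded (R : realType) (g : R -> R) :
  measurable_fun setT g ->
  (forall v, g (u + v) - g u @[u --> +oo] --> (0 : R)) ->
  \forall u \near +oo, forall v, 0 <= v <= 1 -> `|g (u + v) - g u| <= 2.
Proof.
move=> mg gv0.
pose S (s : R^nat) n : set R := `[0, 3] `&`
  [set x | forall m, (n <= m)%N -> `|g (s m + x) - g (s m)| <= 1].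
have mS s n : measurable (S s n).
  rewrite /S (_ : [set x | _] =
    \bigcap_(m in [set m | (n <= m)%N]) [set x | `|g (s m + x) - g (s m)| <= 1]).
    apply: measurableI => //; apply: bigcap_measurable => [|m nm]; first by exists n => /=.
    have mh : measurable_fun setT (fun x : R => `|g (s m + x) - g (s m)| <= 1).
      apply: measurable_fun_ler => //; apply: measurableT_comp => //.
      apply: measurable_funB => //; apply: measurableT_comp => //.
      exact: measurable_funD.
    have := mh measurableT [set true]; rewrite setTI.
    by apply.
  by apply/seteqP; split => x /=.
(* The sets [S s n] increase to [0, 3] by the pointwise convergence along [s], so their measures
   tend to 3. *)
have S2 s : s @ \oo --> +oo ->
    \forall n \near \oo, (2%:E < lebesgue_measure (S s n))%E.
  move=> soo.
  have UE : \bigcup_n S s n = `[0, 3]%classic.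
    apply/seteqP; split => [x [n _ []]//|x x03].
    have := cvg_comp _ _ soo (gv0 x) => /cvgrPdist_le /(_ _ ltr01) [N _ HN].
    exists N => //; split=> // m Nm.
    by have := HN m Nm; rewrite /= sub0r normrN.
  have : lebesgue_measure (S s n) @[n --> \oo] --> 3%:E.
    have -> : 3%:E = lebesgue_measure (\bigcup_n S s n) :> \bar R.
      by rewrite UE lebesgue_measure_itv/= lte_fin ltr0n oppr0 adde0.
    apply: nondecreasing_cvg_mu.
    - by move=> n; exact: mS.
    - by apply: bigcup_measurable => n _; exact: mS.
    - move=> n p np; apply/subsetPset => x [x03 xn]; split => // m pm.
    by apply: xn; exact: leq_trans pm.
  move=> /(_ [set y | (2%:E < y)%E]); apply; apply: (@open_ereal_gt' _ 3%:E 2%:E).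
  by rewrite lte_fin ltr_nat.
apply: contrapT => /= nearN.
(* If the claim fails, each [n] yields a pair violating the bound of 2 with [u] beyond [n]. *)
have bad n : exists uv : R * R, [/\ n%:R <= uv.1, 0 <= uv.2 <= 1 &
    2 < `|g (uv.1 + uv.2) - g uv.1|].
  apply: contrapT => nbad; apply: nearN.
  apply: filterS (nbhs_pinfty_ge (num_real n%:R)) => u nu v v01.
  by rewrite leNgt; apply/negP => guv; apply: nbad; exists (u, v).
have [uv uvP] := choice bad.
pose u n := (uv n).1; pose v n := (uv n).2.
have uoo : u @ \oo --> +oo.
  apply: (@ger_cvgy _ _ _ _ (fun n => n%:R)); last exact: cvgr_idn.
  by near=> n; have [] := uvP n.
have uvoo : (fun n => u n + v n) @ \oo --> +oo.
  apply: ger_cvgy uoo; near=> n; rewrite lerDl.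
  by have [_ /andP[]] := uvP n.
near \oo => n.
have V2 : (2%:E < lebesgue_measure (S u n))%E by near: n; exact: S2.
have W2 : (2%:E < lebesgue_measure (S (fun n => u n + v n)%R n))%E.
  by near: n; exact: S2.
have [nu /andP[v0 v1] guv] := uvP n; rewrite -/(u n) -/(v n) in v0 v1 guv.
set W := S _ n in W2.
pose W' := (fun x => x - v n) @^-1` W.
have mW' : measurable W'.
  have mc : measurable_fun setT (fun x : R => x - v n) by exact: measurable_funB.
  by have := mc measurableT W (mS _ _); rewrite setTI.
have W'2 : (2%:E < lebesgue_measure W')%E.
  by rewrite lebesgue_measure_shift//; exact: mS.
have [VW0|/set0P[x [[x03 Vx] [Wx03 Wx]]]] := eqVneq (S u n `&` W') set0.
  have : (lebesgue_measure (S u n `|` W') <=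
      lebesgue_measure (`[0%R, 4%R]%classic : set R))%E.
    apply: le_measure; rewrite ?inE//.
      by apply: measurableU; [exact: mS|exact: mW'].
    move=> x /= [[]|[]]; rewrite /= !in_itv/= => /andP[x0 x3] _; apply/andP; split.
    - exact: x0.
    - by rewrite (le_trans x3)// ler_nat.
    - by rewrite subr_ge0 in x0; rewrite (le_trans v0).
    - move: x3; rewrite lerBlDr => /le_trans; apply.
      by rewrite -[4]/(3 + 1)%:R natrD lerD2l.
  rewrite lebesgue_measure_itv/= lte_fin ltr0n/= oppr0 adde0 measureU//; last exact: mS.
  rewrite leNgt => /negP; apply.
  rewrite -[4]/(2 + 2)%:R natrD EFinD.
  exact: lteD.
(* At the common point both increments lead to [g (u n + x)] and are at most 1, which contradicts
   the choice of the pair. *)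
have := Vx n (leqnn n); have := Wx n (leqnn n).
have -> : u n + v n + (x - v n) = u n + x by ring.
move=> Wn Vn; move: guv; rewrite ltNge => /negP; apply.
have -> : g (u n + v n) - g (u n) =
    (g (u n + x) - g (u n)) - (g (u n + x) - g (u n + v n)) by ring.
by rewrite (le_trans (ler_normB _ _))// -[2]/(1 + 1)%:R natrD lerD.
Unshelve. all: by end_near. Qed.

(** Far enough out, each unit step costs at most [e], and the remaining step of length at most 1
    costs at most 2. *)
Lemma slowly_varying_growth (R : realType) (g : R -> R) (e : R) :
  measurable_fun setT g ->
  (forall v, g (u + v) - g u @[u --> +oo] --> (0 : R)) -> 0 < e ->
  \forall u \near +oo, forall w, 0 <= w -> `|g (u + w) - g u| <= 2 + e * w.
Proof.
move=> mg gv0 e0.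
have [M [_ HM]] : \forall u \near +oo,
    (forall v, 0 <= v <= 1 -> `|g (u + v) - g u| <= 2) /\ `|g (u + 1) - g u| <= e.
  near=> u; split; first by near: u; exact: slowly_varying_bounded.
  rewrite -normrN -[X in `|X|]add0r; near: u.
  by have /cvgrPdist_le := gv0 1; apply.
suff H k u w : M < u -> 0 <= w <= k.+1%:R -> `|g (u + w) - g u| <= 2 + e * w.
  apply: filterS (nbhs_pinfty_gt (num_real M)) => u Mu w w0.
  by apply: (H (Num.truncn w)) => //; rewrite w0 ltW// truncnS_gt.
elim: k u w => [|k IH] u w Mu /andP[w0 wk].
  rewrite (@le_trans _ _ 2)//; first by apply: (HM u Mu).1; rewrite w0.
  by rewrite lerDl mulr_ge0// ltW.
have [w1|w1] := leP w 1.
  rewrite (@le_trans _ _ 2)//; first by apply: (HM u Mu).1; rewrite w0.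
  by rewrite lerDl mulr_ge0// ltW.
have -> : g (u + w) - g u = (g (u + 1 + (w - 1)) - g (u + 1)) + (g (u + 1) - g u).
  have -> : u + 1 + (w - 1) = u + w by ring.
  by ring.
apply: (le_trans (ler_normD _ _)).
have -> : 2 + e * w = 2 + e * (w - 1) + e by ring.
apply: lerD; last exact: (HM u Mu).2.
apply: IH; first by rewrite (lt_trans Mu)// ltrDl.
by rewrite subr_ge0 ltW//= lerBlDr natr1.
Unshelve. all: by end_near. Qed.

Lemma expR_cvgy (R : realType) : @expR R x @[x --> +oo] --> +oo.
Proof.
apply/cvgryPge => A; near=> x.
rewrite (@le_trans _ _ (1 + x))// ?expR_ge1Dx//.
by rewrite -lerBlDl; near: x; apply: nbhs_pinfty_ge; exact: num_real.
Unshelve. all: by end_near. Qed.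

(* Potter's bounds, with exponent 0 in place of rho + e and 2 rho in place of
   rho - e. *)
Lemma regularly_varying_potter (R : realType) (D : R -> R) (rho : R) :
  measurable_fun setT D -> rho < 0 -> (\forall t \near +oo, 0 < D t) ->
  regularly_varying rho D ->
  exists2 K : R, 0 < K & \forall t \near +oo, forall s, t <= s ->
    D s <= K * D t /\ D t <= K * (s / t) `^ (- (2 * rho)) * D s.
Proof.
move=> mD rho0 D0 Drho.
(* In logarithmic scale, with the power of index [rho] removed, regular variation says that the
   increments of [g] tend to 0. *)
pose g u := ln (D (expR u)) - rho * u.
have mg : measurable_fun setT g.
  apply: measurable_funB; last by apply: measurable_funM.
  apply: (measurableT_comp (@measurable_ln R)).
  by apply: measurableT_comp.
have gv0 v : g (u + v) - g u @[u --> +oo] --> (0 : R).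
  have -> : 0 = ln (expR v `^ rho) - rho * v.
    by rewrite -expRM expRK; ring.
  have Dv : ln (D (expR u * expR v) / D (expR u)) - rho * v @[u --> +oo]
      --> ln (expR v `^ rho) - rho * v.
    apply: cvgB; last exact: cvg_cst.
    apply: continuous_cvg.
      by apply: continuous_ln; rewrite powR_gt0// expR_gt0.
    exact: (cvg_comp _ _ (@expR_cvgy R) (Drho _ (expR_gt0 v))).
  apply: cvg_trans Dv; apply: near_eq_cvg.
  have [M [_ HM]] : \forall u \near +oo, 0 < D (expR u) by exact: (@expR_cvgy R _ D0).
  have near_gt (r : R) : \forall u \near +oo, r < u by apply: nbhs_pinfty_gt; exact: num_real.
  apply: filterS2 (near_gt M) (near_gt (M - v)) => u Mu; rewrite ltrBlDr => Muv.
  rewrite /g -expRD ln_div ?posrE ?HM//; ring.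
have [M [_ HM]] : \forall u \near +oo, 0 < D (expR u) /\
    forall w, 0 <= w -> `|g (u + w) - g u| <= 2 + (- rho) * w.
  near=> u; split; first by near: u; exact: (@expR_cvgy R _ D0).
  by near: u; apply: slowly_varying_growth; rewrite ?oppr_gt0.
(* The additive 2 of the growth bound, taken with rate [- rho], becomes the factor [expR 2]. *)
exists (expR 2); first exact: expR_gt0.
near=> t => s ts.
have Mt : expR M < t by near: t; apply: nbhs_pinfty_gt; exact: num_real.
have t0 : 0 < t by rewrite (lt_trans _ Mt)// expR_gt0.
have s0 : 0 < s by exact: lt_le_trans ts.
have tE : expR (ln t) = t by rewrite lnK.
have sE : expR (ln s) = s by rewrite lnK.
have Mlt : M < ln t by rewrite -ltr_expR tE.
have lts : ln t <= ln s by rewrite ler_ln.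
have Mls : M < ln s by exact: lt_le_trans lts.
have [Dt] := HM _ Mlt; have [Ds _] := HM _ Mls.
rewrite sE in Ds; rewrite tE in Dt.
move=> /(_ (ln s - ln t)); rewrite subr_ge0 [ln t + _]addrC subrK => /(_ lts).
rewrite /g sE tE ler_norml => /andP[lo hi].
split; rewrite -ler_ln ?posrE ?mulr_gt0 ?powR_gt0 ?divr_gt0 ?expR_gt0//.
  by rewrite lnM ?posrE ?expR_gt0// expRK; lra.
rewrite !lnM ?posrE ?mulr_gt0 ?powR_gt0 ?divr_gt0 ?expR_gt0// expRK.
rewrite ln_powR ln_div ?posrE//; nra.
Unshelve. all: by end_near. Qed.

(** The form of [A] turns the second-order limit into regular variation of [|1 - L|] with index
    [rho], to which Potter's bounds apply. Rounding their exponent up to a multiple of [alpha] makes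
    the factor an integer power of [(s / t) ^ alpha]. *)
Lemma second_order_tail_potter (R : realType) (alpha rho ell : R)
    (F L A : R -> R) :
  0 < alpha -> rho < 0 -> 0 < ell -> nondecreasing F ->
  (forall x, 0 < x -> 1 - F x = ell * x `^ (- alpha) * L x) ->
  L t @[t --> +oo] --> (1 : R) ->
  (forall t, 0 < t -> A t = - rho * (1 - L t) / L t) ->
  second_order_regularly_varying (- alpha) rho A (fun x => 1 - F x) ->
  exists (K : R) (k : nat), 0 < K /\ \forall t \near +oo, forall s, t <= s ->
    `|1 - L s| <= K * `|1 - L t| /\
    `|1 - L t| <= K * ((s / t) `^ alpha) ^+ k * `|1 - L s|.
Proof.
move=> al0 rho0 ell0 ndF tailF L1 AE [_ A0 RV2].
(* [D] equals [|1 - L|] on the positive reals; written through the monotone [F], it is measurable on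
   the whole line. *)
pose D (x : R) : R := `|1 - (1 - F x) * x `^ alpha / ell|.
have DE (x : R) : 0 < x -> D x = `|1 - L x|.
  move=> x0; rewrite /D tailF// powRN; congr `|1 - _|.
  by field; rewrite !gt_eqF// powR_gt0.
have mD : measurable_fun setT D.
  apply: measurableT_comp => //; apply: measurable_funB => //.
  apply: measurable_funM => //; apply: measurable_funM; last exact: measurable_powR.
  by apply: measurable_funB => //; exact: nondecreasing_measurable.
have Lgt0 : \forall t \near +oo, 0 < L t by apply: (cvgr_gt _ L1).
have pos_near : \forall t \near +oo, (0 : R) < t.
  by apply: nbhs_pinfty_gt; exact: num_real.
(* [A] vanishes at positive points where [L] is 1, which its ultimately strict sign excludes. *)
have L_neq1 : \forall t \near +oo, 1 - L t != 0.
  case: A0 => A0; near=> t.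
    have At : 0 < A t by near: t.
    by apply: contraTneq At => Lt; rewrite AE ?Lt ?mulr0 ?mul0r ?ltxx//; near: t.
  have At : A t < 0 by near: t.
  by apply: contraTneq At => Lt; rewrite AE ?Lt ?mulr0 ?mul0r ?ltxx//; near: t.
have RVD : regularly_varying rho D.
  move=> x x0; have x1 : x `^ alpha != 0 by rewrite gt_eqF// powR_gt0.
  (* Substituting the formulas for the tail and for [A] reduces [f t] to
     [(1 - L (t x)) / (1 - L t)]. *)
  pose f (t : R) : R := 1 + rho * x `^ alpha *
    ((A t)^-1 * ((1 - F (t * x)) / (1 - F t) - x `^ (- alpha))).
  have lim : `|f t| @[t --> +oo] --> x `^ rho.
    rewrite -[x `^ rho]ger0_norm ?powR_ge0//; apply: cvg_norm.
    have -> : x `^ rho = 1 + rho * x `^ alpha *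
        (x `^ (- alpha) * ((x `^ rho - 1) / rho)).
      by rewrite powRN; field; rewrite x1 lt_eqF.
    apply: cvgD; first exact: cvg_cst.
    by apply: cvgMr; exact: RV2.
  apply: cvg_trans lim; apply: near_eq_cvg; near=> t.
  have t0 : 0 < t by near: t.
  have Lt : 0 < L t by near: t.
  have L1t : 1 - L t != 0 by near: t.
  rewrite /f !DE ?mulr_gt0// AE// !tailF ?mulr_gt0// -normfV -normrM.
  rewrite powRM ?ltW// !powRN; congr `|_|.
  by field; rewrite x1 L1t (lt_eqF rho0) !gt_eqF ?powR_gt0.
have Dpos : \forall t \near +oo, 0 < D t.
  near=> t; have t0 : 0 < t by near: t.
  by rewrite DE// normr_gt0; near: t.
have [K K0 HK] := regularly_varying_potter mD rho0 Dpos RVD.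
pose k := (Num.truncn (- (2 * rho) / alpha)).+1.
exists K, k; split => //; near=> t => s ts.
have t0 : 0 < t by near: t.
have s0 : 0 < s by exact: lt_le_trans ts.
have [//|H1 H2] := (near HK t _) s ts.
rewrite -!DE//; split => //; apply: (le_trans H2).
rewrite ler_wpM2r ?normr_ge0// ler_pM2l//.
rewrite -powR_mulrn ?powR_ge0// -powRrM ler_powR//.
  by rewrite ler_pdivlMr// mul1r.
by rewrite [alpha * _]mulrC -ler_pdivrMr//; apply/ltW; exact: truncnS_gt.
Unshelve. all: by end_near. Qed.

(** * Pointwise approximation of the distribution function of the maximum *)

(** With [w = c z / (k + 1)], the exponential of [c z] is [expR w ^+ k.+1], and [w <= expR w].
    Dividing by [k + 1] instead of [k] covers [k = 0]. *)
Lemma expr_mul_expRN_bounded (R : realType) (c : R) (k : nat) : 0 < c ->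
  exists2 K : R, 0 < K & forall z, 0 <= z -> z ^+ k * expR (- (c * z)) <= K.
Proof.
move=> c0; pose m : R := k.+1%:R; have m0 : 0 < m by rewrite ltr0n.
have mc0 : 0 < m / c by exact: divr_gt0.
exists ((m / c) ^+ k); first exact: exprn_gt0.
move=> z z0.
rewrite expRN ler_pdivrMr ?expR_gt0//.
pose w := c * z / m.
have w0 : 0 <= w by rewrite divr_ge0 ?mulr_ge0// ltW.
have -> : z = m / c * w.
  by rewrite /w; field; rewrite !gt_eqF.
rewrite exprMn ler_pM2l ?exprn_gt0//.
have -> : c * (m / c * w) = w * m.
  by rewrite /w; field; rewrite !gt_eqF.
rewrite expRM_natr.
apply: (@le_trans _ _ (expR w ^+ k)).
  by apply: lerXn2r; rewrite ?nnegrE ?expR_ge0// (le_trans _ (expR_ge1Dx w))// lerDr.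
by apply: ler_weXn2l => //; rewrite -expR0 ler_expR.
Qed.

Lemma bernoulli_ineq (R : realType) (n : nat) (s : R) :
  0 <= s <= 1 -> 1 - n%:R * s <= (1 - s) ^+ n.
Proof.
move=> /andP[s0 s1]; elim: n => [|n IH]; first by rewrite mul0r subr0 expr0.
rewrite exprS; apply: (@le_trans _ _ ((1 - s) * (1 - n%:R * s))).
  have : 0 <= n%:R * s * s by rewrite !mulr_ge0.
  by rewrite -natr1; nra.
by rewrite ler_wpM2l// subr_ge0.
Qed.

(** With [t = y / n], the power is at most [expR (- y)] since [1 - t <= expR (- t)]. Conversely [1 -
    t^2 = (1 - t) (1 + t) <= (1 - t) expR t], so the power is at least [expR (- y) (1 - t^2)^n], and
    Bernoulli's inequality gives [(1 - t^2)^n >= 1 - y^2 / n]. *)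
Lemma expRN_sub_expr (R : realType) (n : nat) (y : R) :
  (0 < n)%N -> 0 <= y <= n%:R ->
  `|(1 - y / n%:R) ^+ n - expR (- y)| <= y ^+ 2 * expR (- y) / n%:R.
Proof.
move=> n0 /andP[y0 yn]; have n0' : 0 < n%:R :> R by rewrite ltr0n.
set t := y / n%:R.
have t0 : 0 <= t by rewrite divr_ge0// ltW.
have t1 : t <= 1 by rewrite ler_pdivrMr// mul1r.
have eE : expR (- y) = expR (- t) ^+ n.
  by rewrite -expRM_natr /t; congr expR; field; rewrite gt_eqF.
have up : (1 - t) ^+ n <= expR (- y).
  by rewrite eE; apply: lerXn2r; rewrite ?nnegrE ?expR_ge0 ?subr_ge0// expR_ge1Dx.
rewrite ler0_norm ?subr_le0// opprB lerBlDr -lerBlDl.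
have bern : 1 - n%:R * t ^+ 2 <= (1 - t ^+ 2) ^+ n.
  by apply: bernoulli_ineq; rewrite sqr_ge0 expr_le1.
apply: (@le_trans _ _ (expR (- y) * (1 - n%:R * t ^+ 2))).
  by rewrite le_eqVlt; apply/orP; left; apply/eqP; rewrite /t; field; rewrite gt_eqF.
apply: (@le_trans _ _ (expR (- y) * (1 - t ^+ 2) ^+ n)).
  by rewrite ler_pM2l ?expR_gt0.
rewrite eE -exprMn; apply: lerXn2r; rewrite ?nnegrE.
- by rewrite mulr_ge0 ?expR_ge0// subr_ge0 expr_le1.
- by rewrite subr_ge0.
rewrite expRN mulrC ler_pdivrMr ?expR_gt0//.
have -> : 1 - t ^+ 2 = (1 - t) * (1 + t) by ring.
by rewrite ler_wpM2l ?subr_ge0// expR_ge1Dx.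
Qed.

Lemma expRN_sub_le (R : realType) (c y z : R) : c <= y -> c <= z ->
  `|expR (- y) - expR (- z)| <= `|y - z| * expR (- c).
Proof.
wlog yz : y z / y <= z => [H cy cz|cy cz].
  have [yz|/ltW zy] := leP y z; first exact: H.
  by rewrite distrC (distrC y); exact: H.
rewrite ger0_norm; last by rewrite subr_ge0 ler_expR lerN2.
rewrite ler0_norm ?subr_le0// opprB.
apply: (@le_trans _ _ ((z - y) * expR (- y))); last first.
  by rewrite ler_wpM2l ?subr_ge0// ler_expR lerN2.
have -> : - z = - y + (y - z) by ring.
rewrite expRD -{1}[expR (- y)]mulr1 -mulrBr mulrC ler_wpM2r ?expR_ge0//.
by have := expR_ge1Dx (y - z); lra.
Qed.

Lemma expr_le_inv (R : realType) (q : R) : 0 <= q < 1 ->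
  exists2 K : R, 0 < K & forall n : nat, (0 < n)%N -> q ^+ n <= K / n%:R.
Proof.
move=> /andP[q0 q1].
have q1' : 0 < 1 - q by rewrite subr_gt0.
have [K K0 HK] := expr_mul_expRN_bounded 1 q1'.
exists K => // n n0; rewrite ler_pdivlMr ?ltr0n//.
apply: le_trans (HK n%:R _) => //.
rewrite expr1 mulrC ler_wpM2l// -mulNr expRM_natr; apply: lerXn2r.
- by rewrite nnegrE.
- by rewrite nnegrE expR_ge0.
by have := expR_ge1Dx (- (1 - q)); lra.
Qed.

(** Here [m z l] stands for [n (1 - F (a x))], with [z = x ^ (- alpha)], [l = L (a x)] and [m] the
    scale factor at [a]. As [m] and [l] are within 1/2 of 1, [y = m z l] lies between [z / 4] and
    [4 z]; every error then carries a factor [expR (- z / 4)], which absorbs the powers of [z]. *)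
Lemma bulk_estimate (R : realType) (c1 c2 : R) (k : nat) : 0 <= c1 -> 0 <= c2 ->
  exists2 C : R, 0 < C & forall (n : nat) (m l z e : R), (0 < n)%N ->
    0 < z -> 0 <= e -> `|m - 1| <= 2^-1 -> `|l - 1| <= 2^-1 ->
    `|m - 1| <= c1 * e -> `|l - 1| <= c2 * e * (1 + z ^+ k) ->
    m * z * l <= n%:R ->
    `|(1 - m * z * l / n%:R) ^+ n - expR (- z)| <= C * (n%:R^-1 + e) * Num.min 1 z.
Proof.
move=> c10 c20; have q0 : (0 : R) < 4^-1 by rewrite invr_gt0.
have [K0 K00 HK0] := expr_mul_expRN_bounded 0 q0.
have [K1 K10 HK1] := expr_mul_expRN_bounded 1 q0.
have [K2 K20 HK2] := expr_mul_expRN_bounded 2 q0.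
have [Kk Kk0 HKk] := expr_mul_expRN_bounded k q0.
have [Kk1 Kk10 HKk1] := expr_mul_expRN_bounded k.+1 q0.
(* [B] bounds all the products of a power of [z] with [expR (- z / 4)] that occur below; in [c3] the
   factor 2 bounds [|l|]. *)
pose B := K0 + K1 + K2 + Kk + Kk1.
pose c3 := 2 * c1 + c2.
exists ((16 + c3) * B); first by rewrite mulr_gt0 /B /c3; lra.
move=> n m l z e n0 z0 e0 + + m1 l1 yn; rewrite !(ler_norml _ 2^-1) => mb lb.
set y := m * z * l in yn *.
have /andP[mlo mhi] := mb; have /andP[llo lhi] := lb.
have ylo : 4^-1 * z <= y.
  have : 0 <= (m - 2^-1) * (l - 2^-1) by rewrite mulr_ge0; lra.
  by rewrite /y; nra.
have yhi : y <= 4 * z.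
  have : 0 <= (3/2 - m) * l by rewrite mulr_ge0; lra.
  have : m * l <= 9/4 by nra.
  by rewrite /y; nra.
have n0' : 0 < n%:R :> R by rewrite ltr0n.
have y0 : 0 <= y by lra.
have E0 : 0 <= expR (- (4^-1 * z)) := expR_ge0 _.
have H1 : `|(1 - y / n%:R) ^+ n - expR (- y)| <=
    16 * n%:R^-1 * (z ^+ 2 * expR (- (4^-1 * z))).
  apply: (le_trans (expRN_sub_expr n0 _)); first by rewrite y0.
  have -> : 16 * n%:R^-1 * (z ^+ 2 * expR (- (4^-1 * z))) =
    (4 * z) ^+ 2 * expR (- (4^-1 * z)) / n%:R by ring.
  rewrite ler_pM2r ?invr_gt0//; apply: ler_pM => //; rewrite ?sqr_ge0 ?expR_ge0//.
    by apply: lerXn2r; rewrite ?nnegrE// (le_trans y0).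
  by rewrite ler_expR lerN2.
have yz : `|y - z| <= c3 * e * (z * (1 + z ^+ k)).
  have -> : y - z = z * ((m - 1) * l + (l - 1)) by rewrite /y; ring.
  rewrite normrM (ger0_norm (ltW z0)).
  have -> : c3 * e * (z * (1 + z ^+ k)) = z * (c3 * e * (1 + z ^+ k)) by ring.
  rewrite ler_wpM2l ?(ltW z0)//; apply: (le_trans (ler_normD _ _)).
  have zk0 : 0 <= z ^+ k by rewrite exprn_ge0// ltW.
  have -> : c3 * e * (1 + z ^+ k) =
    2 * c1 * e * (1 + z ^+ k) + c2 * e * (1 + z ^+ k) by rewrite /c3; ring.
  apply: lerD => //.
  rewrite normrM.
  have l2 : `|l| <= 2 by rewrite ler_norml; lra.
  have := ler_pM (normr_ge0 _) (normr_ge0 _) m1 l2.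
  have : 0 <= c1 * e by rewrite mulr_ge0.
  by nra.
have H2 : `|expR (- y) - expR (- z)| <=
    c3 * e * ((z + z ^+ k.+1) * expR (- (4^-1 * z))).
  apply: (le_trans (expRN_sub_le ylo _)); first by lra.
  apply: (le_trans (ler_wpM2r E0 yz)).
  by rewrite exprS le_eqVlt; apply/orP; left; apply/eqP; ring.
have z0' := ltW z0.
have {}HK0 := HK0 z z0'; have {}HK1 := HK1 z z0'; have {}HK2 := HK2 z z0'.
have {}HKk := HKk z z0'; have {}HKk1 := HKk1 z z0'.
set E := expR (- (4^-1 * z)) in HK0 HK1 HK2 HKk HKk1 E0 H1 H2.
(* For [z < 1] one factor [z] is set apart to produce the minimum; for [z >= 1] the whole product is
   bounded. *)
have P2 : z ^+ 2 * E <= B * Num.min 1 z.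
  have [z1|z1] := leP 1 z; first by rewrite mulr1 (le_trans HK2)// /B; lra.
  have -> : z ^+ 2 * E = z ^+ 1 * E * z by ring.
  by rewrite ler_pM2r// (le_trans HK1)// /B; lra.
have P1 : (z + z ^+ k.+1) * E <= B * Num.min 1 z.
  have [z1|z1] := leP 1 z.
    by rewrite mulr1 mulrDl; move: HK1; rewrite expr1 /B; lra.
  have -> : (z + z ^+ k.+1) * E = (z ^+ 0 * E + z ^+ k * E) * z.
    by rewrite exprS; ring.
  by rewrite ler_pM2r// /B; lra.
have c30 : 0 <= c3 by rewrite /c3; lra.
have n1 : 0 <= n%:R^-1 :> R by rewrite invr_ge0 ltW.
have BM : 0 <= B * Num.min 1 z.
  by rewrite mulr_ge0//; [rewrite /B; lra|rewrite le_min ler01].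
have -> : (1 - y / n%:R) ^+ n - expR (- z) =
  ((1 - y / n%:R) ^+ n - expR (- y)) + (expR (- y) - expR (- z)) by ring.
apply: (le_trans (ler_normD _ _)).
apply: (@le_trans _ _ (16 * n%:R^-1 * (B * Num.min 1 z) + c3 * e * (B * Num.min 1 z))).
  apply: lerD; [apply: (le_trans H1)|apply: (le_trans H2)].
    by rewrite ler_wpM2l// mulr_ge0.
  by rewrite ler_wpM2l// mulr_ge0.
rewrite -subr_ge0.
have -> : (16 + c3) * B * (n%:R^-1 + e) * Num.min 1 z -
    (16 * n%:R^-1 * (B * Num.min 1 z) + c3 * e * (B * Num.min 1 z)) =
  (c3 * n%:R^-1 + 16 * e) * (B * Num.min 1 z) by ring.
by rewrite mulr_ge0// addr_ge0 ?mulr_ge0.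
Qed.

Lemma powR_continuous_gt0 (R : realType) (p a : R) : 0 < a ->
  {for a, continuous (fun x => x `^ p)}.
Proof.
move=> a0.
have /derivable1_diffP/differentiable_continuous :
    derivable (fun x => x `^ p) a 1.
  by apply: derivable_powR; rewrite in_itv/= a0.
exact.
Qed.

(* With a = a_n, the quantity [n * (ell * a `^ (- alpha))] is [n (1 - F a)]
   divided by [L a], equal to 1 when F is continuous at a and L a = 1; a jump
   of F at a costs no more than the second-order term e. *)
Lemma quantile_scale (R : realType) (alpha ell e c a : R) (n : nat) :
  0 < ell -> 0 < a -> (0 < n)%N -> 0 <= e <= 2^-1 -> 0 <= c ->
  ell * a `^ (- alpha) * (1 - e) <= n%:R^-1 ->
  (forall s, a / 2 <= s -> s < a ->
    n%:R^-1 <= ell * s `^ (- alpha) * (1 + c * e)) ->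
  `|n%:R * (ell * a `^ (- alpha)) - 1| <= 2 * (c + 1) * e.
Proof.
move=> ell0 a0 n0 /andP[e0 e2] c0 up lo.
have n0' : 0 < n%:R :> R by rewrite ltr0n.
set m := n%:R * _.
have m0 : 0 < m by rewrite !mulr_gt0// powR_gt0.
have mup : m * (1 - e) <= 1.
  by rewrite -(ler_pM2l n0') mulrA mulfV ?gt_eqF// in up.
have mlo : 1 <= m * (1 + c * e).
  suff : n%:R^-1 <= ell * a `^ (- alpha) * (1 + c * e).
    by rewrite -(ler_pM2l n0') mulrA mulfV ?gt_eqF.
  (* The lower bound passes to the left limit at [a] because the power function is continuous
     there. *)
  rewrite leNgt; apply/negP => H.
  near a^'- => s.
  have : ell * s `^ (- alpha) * (1 + c * e) < n%:R^-1.
    near: s; apply: cvgr_lt H.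
    apply: cvg_at_left_filter; apply: cvgM; last exact: cvg_cst.
    by apply: cvgM; [exact: cvg_cst|exact: powR_continuous_gt0].
  apply/negP; rewrite -leNgt; apply: lo; near: s.
    by apply: nbhs_left_ge; rewrite ltr_pdivrMr// ltr_pMr// ltr1n.
  exact: nbhs_left_lt.
have m2 : m <= 2 by nra.
have ce : 0 <= c * e by rewrite mulr_ge0.
by rewrite ler_norml; apply/andP; split; nra.
Unshelve. all: by end_near. Qed.

(** This serves points [a x] below a fixed threshold: [F (a x)^n] is at most a geometric term, and
    [z = x ^ (- alpha)] is at least a multiple of [n], so [expR (- z) <= 1 / z] is of order
    [1 / n]. *)
Lemma tail_left_estimate (R : realType) (ell q : R) : 0 < ell -> 0 <= q < 1 ->
  exists2 C : R, 0 < C & forall (n : nat) (z : R), (0 < n)%N ->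
    ell * n%:R <= z ->
    q ^+ n + expR (- z) <= C * n%:R^-1.
Proof.
move=> ell0 q01; have [K K0 HK] := expr_le_inv q01.
exists (K + ell^-1); first by rewrite addr_gt0// invr_gt0.
move=> n z n0 nz; have n0' : 0 < n%:R :> R by rewrite ltr0n.
rewrite mulrDl; apply: lerD; first exact: HK.
have z0 : 0 < z by rewrite (lt_le_trans _ nz)// mulr_gt0.
rewrite expRN -invfM lef_pV2 ?posrE ?expR_gt0 ?mulr_gt0//.
by rewrite (le_trans nz)// (le_trans _ (expR_ge1Dx z))// lerDr.
Qed.

(** The cases are separated by a fixed [t0] beyond which [|1 - L| <= 1/2] and Potter's bounds hold.
    If [a x >= t0], the bulk estimate applies, with the first Potter bound for [x >= 1] and the
    second for [x < 1]. If [a x < t0], both terms are of order [1 / n] and the minimum is 1. *)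
Lemma frechet_max_approx (R : realType) (alpha ell : R) (F L : R -> R)
    (K : R) (k : nat) :
  0 < alpha -> 0 < ell -> nondecreasing F -> (forall x, 0 <= F x) ->
  (forall x, 0 < x -> 1 - F x = ell * x `^ (- alpha) * L x) ->
  L t @[t --> +oo] --> (1 : R) -> 0 < K ->
  (\forall t \near +oo, forall s, t <= s ->
    `|1 - L s| <= K * `|1 - L t| /\
    `|1 - L t| <= K * ((s / t) `^ alpha) ^+ k * `|1 - L s|) ->
  exists2 C : R, 0 < C & \forall a \near +oo, forall n : nat, (0 < n)%N ->
    1 - F a <= n%:R^-1 -> (forall s, s < a -> n%:R^-1 <= 1 - F s) ->
    forall x, 0 < x ->
    `|F (a * x) ^+ n - expR (- x `^ (- alpha))| <=
      C * (n%:R^-1 + `|1 - L a|) * Num.min 1 (x `^ (- alpha)).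
Proof.
move=> al0 ell0 ndF F0 tailF L1 K0 Kk.
have near_small e : 0 < e -> \forall t \near +oo, `|1 - L t| <= e.
  by move=> e0; move/cvgrPdist_le : L1 => /(_ e e0).
have [t0 [t00 t0P]] : exists t0, 0 < t0 /\ forall t, t0 <= t ->
    `|1 - L t| <= 2^-1 /\ forall s, t <= s ->
    `|1 - L s| <= K * `|1 - L t| /\
    `|1 - L t| <= K * ((s / t) `^ alpha) ^+ k * `|1 - L s|.
  have [M [_ HM]] : \forall t \near +oo, `|1 - L t| <= 2^-1 /\ forall s, t <= s ->
    `|1 - L s| <= K * `|1 - L t| /\
    `|1 - L t| <= K * ((s / t) `^ alpha) ^+ k * `|1 - L s|.
    by near=> t; split; near: t => //; apply: near_small; rewrite invr_gt0.
  exists (Num.max 1 (M + 1)); split; first by rewrite lt_max ltr01.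
  by move=> t; rewrite ge_max => /andP[_ tM]; apply: HM; lra.
(* The jump estimate compares [L s] with [L a] for [a / 2 <= s < a], so the ratio in Potter's bound
   is at most 2. *)
pose c := K * (2 `^ alpha) ^+ k.
have c0 : 0 <= c by rewrite mulr_ge0 ?exprn_ge0 ?powR_ge0// ltW.
pose c1 := 2 * (c + 1).
have c10 : 0 < c1 by rewrite /c1; lra.
have [C1 C10 HC1] := bulk_estimate k (ltW c10) (ltW K0).
have q01 : 0 <= F t0 < 1.
  rewrite F0 -subr_gt0 tailF// !mulr_gt0 ?powR_gt0//.
  by have [] := t0P t0 (lexx _); rewrite ler_norml; lra.
pose d := t0 `^ (- alpha) * (ell / 2).
have d0 : 0 < d by rewrite !mulr_gt0 ?powR_gt0 ?invr_gt0.
have [C2 C20 HC2] := tail_left_estimate d0 q01.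
exists (C1 + C2); first exact: addr_gt0.
near=> a => n n0 aup alo x x0.
(* This keeps [a / 2] beyond [t0]. *)
have at0 : 2 * t0 <= a by near: a; apply: nbhs_pinfty_ge; exact: num_real.
have a0 : 0 < a by lra.
have t0a : t0 <= a by lra.
have [e2 aP] := t0P a t0a.
have e1 : `|1 - L a| <= (2 * c1)^-1.
  by near: a; apply: near_small; rewrite invr_gt0 mulr_gt0.
set e := `|1 - L a| in e2 e1 *; have e0 : 0 <= e by exact: normr_ge0.
have n0' : 0 < n%:R :> R by rewrite ltr0n.
have ea0 : 0 < ell * a `^ (- alpha) by rewrite mulr_gt0// powR_gt0.
have DL s : L s <= 1 + `|1 - L s| /\ 1 - `|1 - L s| <= L s.
  by have := ler_norm (1 - L s); have := ler_norm (- (1 - L s)); rewrite normrN; clear; lra.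
pose m := n%:R * (ell * a `^ (- alpha)).
have m1 : `|m - 1| <= c1 * e.
  apply: quantile_scale => //; first by rewrite e0.
    by apply: le_trans aup; rewrite tailF// ler_pM2l//; exact: (DL a).2.
  move=> s as_ sa; apply: (le_trans (alo _ sa)).
  have st0 : t0 <= s by clear -as_ at0; lra.
  have s0 : 0 < s by clear -st0 t00; lra.
  rewrite tailF// ler_pM2l ?mulr_gt0 ?powR_gt0//.
  apply: (le_trans (DL s).1); rewrite lerD2l.
  have [_ /(_ a (ltW sa)) [_ H]] := t0P s st0.
  apply: (le_trans H); rewrite ler_wpM2r// ler_wpM2l ?(ltW K0)//.
  apply: lerXn2r; rewrite ?nnegrE ?powR_ge0//.
  apply: ge0_ler_powR; rewrite ?nnegrE//; first exact: ltW.
    by rewrite divr_ge0// ltW.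
  by rewrite ler_pdivrMr//; clear -as_; lra.
have m2 : `|m - 1| <= 2^-1.
  apply: (le_trans m1); rewrite (@le_trans _ _ (c1 * (2 * c1)^-1))//.
    by rewrite ler_pM2l.
  by rewrite invfM mulrCA mulfV ?mulr1// gt_eqF.
set z := x `^ (- alpha); have z0 : 0 < z by exact: powR_gt0.
have M0 : 0 <= Num.min 1 z by rewrite le_min ler01 ltW.
have ne0 : 0 <= n%:R^-1 + e by rewrite addr_ge0// invr_ge0 ltW.
have tailE : 1 - F (a * x) = m * z * L (a * x) / n%:R.
  rewrite tailF ?mulr_gt0// powRM ?ltW// /m /z.
  by field; rewrite gt_eqF.
have [axt0|axt0] := leP t0 (a * x).
  have [l2 axP] := t0P _ axt0.
  have FE : F (a * x) = 1 - m * z * L (a * x) / n%:R by rewrite -tailE; ring.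
  rewrite FE; apply: (@le_trans _ _ (C1 * (n%:R^-1 + e) * Num.min 1 z)).
    apply: HC1 => //.
    - by rewrite distrC.
    - rewrite distrC; have zk0 : 0 <= z ^+ k by rewrite exprn_ge0// ltW.
      have Ke0 : 0 <= K * e by rewrite mulr_ge0// ltW.
      have [x1|x1] := leP 1 x.
        have aax : a <= a * x by rewrite ler_peMr// ltW.
        have [H _] := aP _ aax.
        by apply: (le_trans H); rewrite ler_peMr// lerDl.
      have axa : a * x <= a by rewrite ger_pMr// ltW.
      have [_ H] := axP a axa.
      apply: (le_trans H).
      (* The Potter factor [(a / (a x)) ^ alpha] is [z] itself, which produces the term [z ^+ k]. *)
      have -> : a / (a * x) = x `^ (-1).
        by rewrite powR_inv1 ?ltW//; field; rewrite !gt_eqF.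
      rewrite -powRrM mulN1r -/z mulrAC ler_wpM2l// lerDr ler01//.
    - by have := F0 (a * x); rewrite FE subr_ge0 ler_pdivrMr// mul1r.
  by rewrite ler_wpM2r// ler_wpM2r// lerDl ltW.
have x1 : x < 1 by rewrite -(ltr_pM2l a0) mulr1; clear -axt0 at0 t00; lra.
have xal0 : 0 < x `^ alpha by exact: powR_gt0.
have aal0 : 0 < a `^ alpha by exact: powR_gt0.
have tal0 : 0 < t0 `^ alpha by exact: powR_gt0.
have powle (u v : R) : 0 <= u -> u <= v -> u `^ alpha <= v `^ alpha.
  move=> u0 uv; apply: ge0_ler_powR; rewrite ?nnegrE//; first exact: ltW.
  exact: le_trans uv.
(* From [m <= 2] follows [a ^ alpha >= ell n / 2], while [a x < t0] gives [z >= (a / t0) ^ alpha];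
   this is where [d] comes from. *)
have zd : d * n%:R <= z.
  have nle : ell / 2 * n%:R <= a `^ alpha.
    have : m * a `^ alpha = n%:R * ell.
      by rewrite /m powRN; field; rewrite gt_eqF.
    move: m2; rewrite ler_norml => /andP[_ m2]; have : m <= 2 by clear -m2; lra.
    rewrite -(ler_pM2r aal0); clear; lra.
  have xat : a `^ alpha * x `^ alpha <= t0 `^ alpha.
    by rewrite -powRM ?(ltW a0) ?(ltW x0)// powle// ltW// mulr_gt0.
  rewrite /z /d !powRN -mulrA mulrC ler_pdivrMr// -ler_pdivrMl ?invr_gt0//.
  rewrite invrK mulrC; apply: le_trans xat.
  by rewrite ler_pM2r.
have z1 : 1 <= z.
  rewrite /z powRN invf_ge1//; have := powle x 1 (ltW x0) (ltW x1).
  by rewrite powR1.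
rewrite (min_idPl z1) mulr1.
have Fn0 : 0 <= F (a * x) ^+ n by rewrite exprn_ge0.
apply: (@le_trans _ _ (F t0 ^+ n + expR (- z))).
  have : F (a * x) ^+ n <= F t0 ^+ n.
    by apply: lerXn2r; rewrite ?nnegrE//; apply: ndF; exact: ltW.
  by have := expR_ge0 (- z); rewrite ler_norml; clear -Fn0; lra.
apply: (le_trans (HC2 _ _ n0 zd)).
apply: ler_pM; rewrite ?invr_ge0 ?(ltW C20) ?(ltW n0') ?lerDl ?lerDr ?(ltW C10)//.
Unshelve. all: by end_near. Qed.

(** * Integrated estimates *)

Lemma cdf_normalized_max d (T : measurableType d) (R : realType)
    (P : probability T R) (X : nat -> {RV P >-> R}) (F : R -> R)
    (a : nat -> R) (n : nat) (x : R) :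
  mutually_independent X -> (forall i x, cdf (X i) x = (F x)%:E) ->
  (0 < n)%N -> 0 < a n ->
  cdf (normalized_max X a n : {RV P >-> R}) x = (F (a n * x) ^+ n)%:E.
Proof.
move=> indep XF n0 a0.
pose J := [fset (nat_of_ord i) | i in 'I_n]%fset.
have -> : cdf (normalized_max X a n : {RV P >-> R}) x =
    P (\bigcap_(j in [set` J]) (X j @^-1` `]-oo, a n * x]%classic)).
  rewrite /cdf /distribution /pushforward; congr (P _).
  have maxE t : (normalized_max X a n t <= x) = [forall i : 'I_n, X i t <= a n * x].
    rewrite /normalized_max ler_pdivrMl// /sample_max.
    apply/idP/forallP => [h i|h].
      by apply: le_trans h; exact: le_bigmax.
    apply/bigmax_leP; split => //.
    (* The default [X 0] of the iterated maximum is one of its terms, as [n > 0]. *)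
    exact: (h (Ordinal n0)).
  apply/seteqP; split => t /=; rewrite in_itv/= maxE.
    move=> /forallP h j /= /imfsetP[i _ ->] /=; rewrite in_itv/=; exact: h.
  move=> h; apply/forallP => i; have := h i; rewrite /= in_itv/=; apply.
  by apply/imfsetP; exists i.
rewrite (indep J (fun=> `]-oo, a n * x]%classic)) => [|j]; last exact: measurable_itv.
under eq_bigr do rewrite [P _]XF.
rewrite prodEFin big_const_seq count_predT iter_mulr_1; congr ((_ ^+ _)%:E).
rewrite card_imfset/=; last exact: val_inj.
by rewrite -cardE card_ord.
Qed.

(** The threshold is lowered one index at a time; each new index only enlarges the constant, since
    [W] is finite and [r] positive there. *)
Lemma finite_patch (R : realType) (Q : nat -> Prop) (W : nat -> \bar R)
    (r : nat -> R) (N : nat) (C : R) : 0 < C ->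
  (forall n, Q n -> 0 < r n) -> (forall n, Q n -> (W n < +oo)%E) ->
  (forall n, (N <= n)%N -> Q n -> (W n <= (C * r n)%:E)%E) ->
  exists2 C' : R, 0 < C' & forall n, Q n -> (W n <= (C' * r n)%:E)%E.
Proof.
move=> C0 r0 Woo; elim: N C C0 => [|N IH] C C0 H; first by exists C => // n; exact: H.
have [QN|nQN] := pselect (Q N); last first.
  apply: (IH C C0) => n; rewrite leq_eqVlt => /predU1P[<-//|]; exact: H.
have rN := r0 N QN.
have [w WN] : exists w : R, (W N <= w%:E)%E.
  by move: (Woo N QN); case: (W N) => [w _|//|_]; [exists w|exists 0; rewrite leNye].
apply: (IH (Num.max C (w / r N))); first by rewrite lt_max C0.
move=> n; rewrite leq_eqVlt => /predU1P[<- _|Nn Qn].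
  by rewrite (le_trans WN)// lee_fin -ler_pdivrMr// le_max lexx orbT.
by rewrite (le_trans (H n Nn Qn))// lee_fin ler_pM2r ?r0// le_max lexx.
Qed.

(** * An integrable envelope for the Fréchet tail *)

Lemma powR_cvgy (R : realType) (p : R) : 0 < p ->
  x `^ p @[x --> +oo] --> (+oo : set_system R).
Proof.
move=> p0; apply/cvgryPge => A; near=> x.
have x0 : 0 < x by near: x; apply: nbhs_pinfty_gt; exact: num_real.
rewrite /powR gt_eqF//; apply: le_trans (expR_ge1Dx _).
by rewrite -lerBlDl -ler_pdivrMl// -ler_expR lnK ?posrE.
Unshelve. all: by end_near. Qed.

Lemma integral_powRN_lty (R : realType) (alpha : R) : 1 < alpha ->
  (\int[lebesgue_measure]_(x in `[1%R, +oo[) (x `^ (- alpha))%:E < +oo)%E.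
Proof.
move=> al1.
have al : 1 - alpha != 0 by rewrite subr_eq0 lt_eqF.
pose H (x : R) := (1 - alpha)^-1 * x `^ (1 - alpha).
have Hd (x : R) : 0 < x -> is_derive x 1 H (x `^ (- alpha)).
  move=> x0.
  have -> : x `^ (- alpha) = (1 - alpha)^-1 *: ((1 - alpha) * x `^ (1 - alpha - 1)).
    by rewrite /GRing.scale/= mulrA mulVf// mul1r; congr (_ `^ _); ring.
  have dx := is_derive1_powR (1 - alpha) x0.
  exact: is_deriveZ.
rewrite (@ge0_continuous_FTC2y _ _ H 1 0) ; first exact: ltry.
- by move=> x x1; rewrite powR_ge0.
- apply: continuous_in_subspaceT => x; rewrite inE/= in_itv/= andbT => x1.
  by apply: powR_continuous_gt0; rewrite (lt_le_trans ltr01).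
- rewrite -[0](mulr0 (1 - alpha)^-1); apply: cvgMr.
  apply: (@cvg_trans _ ((x `^ (alpha - 1))^-1 @[x --> +oo])).
    by apply: near_eq_cvg; near=> x; rewrite -powRN; congr (_ `^ _); ring.
  apply/gtr0_cvgV0; last by apply: powR_cvgy; rewrite subr_gt0.
  near=> x; apply: powR_gt0.
  by near: x; apply: nbhs_pinfty_gt; exact: num_real.
- by move=> x x1; have [] := Hd x (lt_trans ltr01 x1).
- apply: cvg_at_right_filter; apply: cvgMr.
  by apply: powR_continuous_gt0.
- move=> x; rewrite in_itv/= andbT => x1.
  by rewrite derive1E; have [_] := Hd x (lt_trans ltr01 x1).
Unshelve. all: by end_near. Qed.

(** A majorant of [min 1 (x ^ (- alpha))] on the nonnegative reals, zero on the negative ones. The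
    two indicators overlap at 1, where the value is 2. *)
Definition frechet_envelope (R : realType) (alpha x : R) : R :=
  \1_`[0, 1]%classic x + \1_`[1, +oo[%classic x * x `^ (- alpha).

Section frechet_envelope.
Context (R : realType) (alpha : R).

Lemma frechet_envelope_ge0 x : 0 <= frechet_envelope alpha x.
Proof. by rewrite addr_ge0// mulr_ge0// powR_ge0. Qed.

Lemma measurable_frechet_envelope :
  measurable_fun setT (frechet_envelope alpha).
Proof.
apply: measurable_funD; first exact: measurable_indic.
by apply: measurable_funM; [exact: measurable_indic|exact: measurable_powR].
Qed.

Lemma frechet_envelope_ge1 x : 0 <= x <= 1 -> 1 <= frechet_envelope alpha x.
Proof.
move=> x01; rewrite /frechet_envelope indicE mem_set/= ?in_itv//.
by rewrite lerDl mulr_ge0// powR_ge0.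
Qed.

Lemma frechet_envelope_gepow x :
  1 <= x -> x `^ (- alpha) <= frechet_envelope alpha x.
Proof.
move=> x1; rewrite /frechet_envelope [X in _ + X * _]indicE mem_set/= ?in_itv/= ?x1//.
by rewrite mul1r lerDr.
Qed.

Lemma frechet_envelope_min x : 0 <= x ->
  Num.min 1 (x `^ (- alpha)) <= frechet_envelope alpha x.
Proof.
move=> x0; have [x1|x1] := leP x 1.
  by rewrite (le_trans _ (frechet_envelope_ge1 _)) ?x0// ge_min lexx.
by rewrite (le_trans _ (frechet_envelope_gepow (ltW x1)))// ge_min lexx orbT.
Qed.

Lemma integral_frechet_envelope : 1 < alpha ->
  (\int[lebesgue_measure]_x (frechet_envelope alpha x)%:E < +oo)%E.
Proof.
move=> al1; under eq_integral do rewrite /frechet_envelope EFinD.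
have m0 : measurable_fun setT (fun x : R => (\1_`[0, 1]%classic x : R)%:E).
  by apply/measurable_EFinP; exact: measurable_indic.
have m1 : measurable_fun setT
    (fun x : R => (\1_`[1, +oo[%classic x * x `^ (- alpha))%:E).
  apply/measurable_EFinP; apply: measurable_funM; first exact: measurable_indic.
  exact: measurable_powR.
rewrite ge0_integralD//=; last by move=> x _; rewrite lee_fin mulr_ge0// powR_ge0.
rewrite integral_indic//= setIT lebesgue_measure_itv/= lte_fin ltr01.
rewrite lte_add_pinfty ?ltry//.
have := integral_powRN_lty al1; rewrite integral_mkcond; congr (_ < _)%E.
apply: eq_integral => x _; rewrite patchE indicE.
by case: ifPn; rewrite ?mul1r ?mul0r.
Qed.

(** For [x > 0] this is [1 - expR (- z) <= min 1 z]. It controls the first moment of the Fréchet law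
    through its distance to the constant 0. *)
Lemma frechet_cdf_envelope x : 0 < alpha ->
  `|(0 <= x)%R%:R - frechet_cdf alpha x| <= frechet_envelope alpha x.
Proof.
move=> al0; rewrite /frechet_cdf; have [x0|x0] := leP 0 x; last first.
  by rewrite ltNge (ltW x0)/= subrr normr0 frechet_envelope_ge0.
move: x0; rewrite le_eqVlt => /predU1P[<-|x0].
  by rewrite ltxx subr0 normr1 frechet_envelope_ge1// lexx ler01.
apply: le_trans (frechet_envelope_min (ltW x0)).
rewrite x0 ger0_norm; last by rewrite subr_ge0 -expR0 ler_expR oppr_le0 powR_ge0.
rewrite le_min gerBl expR_ge0/=.
by have := expR_ge1Dx (- x `^ (- alpha)); lra.
Qed.

End frechet_envelope.

(** * Wasserstein bounds for the normalized maximum *)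

Lemma wasserstein1_max_le d (T : measurableType d) (R : realType)
    (P : probability T R) (X : nat -> {RV P >-> R}) (F : R -> R)
    (a : nat -> R) (n : nat) (alpha : R) (alpha_gt0 : 0 < alpha) :
  mutually_independent X -> (forall i x, cdf (X i) x = (F x)%:E) ->
  (0 < n)%N -> 0 < a n ->
  ('E_P[fun t => `|normalized_max X a n t|%R] < +oo)%E ->
  (wasserstein1 (distribution P (normalized_max X a n)) (frechet alpha_gt0) <=
   \int[lebesgue_measure]_x
     (`|F (a n * x) ^+ n - frechet_cdf alpha x|%R)%:E)%E.
Proof.
move=> indep XF n0 a0; rewrite unlock => Zoo.
apply: wasserstein1_le_cdf.
- by move=> x; exact: cdf_normalized_max.
- by move=> x; exact: frechet_itvNy.
- rewrite ge0_integral_distribution//=.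
  by apply/measurable_EFinP; exact: (@normr_measurable R setT).
Qed.

Lemma integral_abs_max_cdf d (T : measurableType d) (R : realType)
    (P : probability T R) (X : nat -> {RV P >-> R}) (F : R -> R)
    (a : nat -> R) (n : nat) :
  mutually_independent X -> (forall i x, cdf (X i) x = (F x)%:E) ->
  (0 < n)%N -> 0 < a n ->
  ('E_P[fun t => `|normalized_max X a n t|%R] < +oo)%E ->
  (\int[lebesgue_measure]_x
     (`|F (a n * x) ^+ n - (0 <= x)%R%:R|%R)%:E < +oo)%E.
Proof.
move=> indep XF n0 a0; rewrite unlock; congr (_ < _)%E.
apply: (@integral_abs_cdf _ _ _ _ (normalized_max X a n)) => x.
exact: cdf_normalized_max.
Qed.

Lemma measurable_cdf_power (R : realType) (F : R -> R) (a : R) (n : nat) :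
  nondecreasing F -> measurable_fun setT (fun x => F (a * x) ^+ n).
Proof.
move=> ndF; apply: measurable_funX.
apply: (@measurableT_comp _ _ _ _ _ _ F); first exact: nondecreasing_measurable.
exact: measurable_funM.
Qed.

Lemma measurable_ge0_indic (R : realType) :
  measurable_fun setT (fun x : R => (0 <= x)%R%:R : R).
Proof.
apply: nondecreasing_measurable => // x y xy; rewrite ler_nat.
by have [x0|//] := leP 0 x; rewrite (le_trans x0).
Qed.

(** Both distribution functions are compared with that of the constant 0, at integrable distance
    from each. The finiteness serves the finitely many [n] before the asymptotic regime. *)
Lemma wasserstein1_max_lty d (T : measurableType d) (R : realType)
    (P : probability T R) (X : nat -> {RV P >-> R}) (F : R -> R)
    (a : nat -> R) (n : nat) (alpha : R) (alpha_gt0 : 0 < alpha) :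
  mutually_independent X -> (forall i x, cdf (X i) x = (F x)%:E) ->
  (0 < n)%N -> 0 < a n -> 1 < alpha ->
  ('E_P[fun t => `|normalized_max X a n t|%R] < +oo)%E ->
  (wasserstein1 (distribution P (normalized_max X a n)) (frechet alpha_gt0)
    < +oo)%E.
Proof.
move=> indep XF n0 a0 al1 Zoo.
have [ndF _ _ _] := cdfP (XF 0%N).
have mFn := measurable_cdf_power (a n) n ndF.
apply: (le_lt_trans (wasserstein1_max_le _ indep XF n0 a0 Zoo)).
have mZ : measurable_fun setT
    (fun x : R => (`|F (a n * x) ^+ n - (0 <= x)%R%:R|%R)%:E).
  apply/measurable_EFinP; apply: measurableT_comp => //.
  by apply: measurable_funB => //; exact: measurable_ge0_indic.
have mE : measurable_fun setT (fun x : R => (frechet_envelope alpha x)%:E).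
  by apply/measurable_EFinP; exact: measurable_frechet_envelope.
apply: (@le_lt_trans _ _ (\int[lebesgue_measure]_x
    ((`|F (a n * x) ^+ n - (0 <= x)%R%:R|%R)%:E + (frechet_envelope alpha x)%:E))%E).
  apply: ge0_le_integral => //.
  - apply/measurable_EFinP; apply: measurableT_comp => //.
    apply: measurable_funB => //; apply: nondecreasing_measurable => //.
    exact: frechet_cdf_nondecreasing.
  - exact: emeasurable_funD.
  - move=> x _; rewrite -EFinD lee_fin.
    have := frechet_cdf_envelope x alpha_gt0.
    set u := _ ^+ n; set v := _%:R; set w := frechet_cdf _ _ => h.
    have -> : u - w = (u - v) + (v - w) by ring.
    by rewrite (le_trans (ler_normD _ _))// lerD2l.
rewrite ge0_integralD//=; last by move=> x _; rewrite lee_fin frechet_envelope_ge0.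
apply: lte_add_pinfty; first exact: (integral_abs_max_cdf indep XF).
exact: integral_frechet_envelope.
Qed.

(** The distribution function of [Z_m], for one fixed [m], supplies an integrable majorant on the
    negative half-line, where the Fréchet envelope vanishes. *)
Lemma wasserstein1_max_le_envelope d (T : measurableType d) (R : realType)
    (P : probability T R) (X : nat -> {RV P >-> R}) (F : R -> R)
    (a : nat -> R) (m : nat) (alpha : R) (alpha_gt0 : 0 < alpha) :
  mutually_independent X -> (forall i x, cdf (X i) x = (F x)%:E) ->
  (0 < m)%N -> 0 < a m -> 1 < alpha ->
  ('E_P[fun t => `|normalized_max X a m t|%R] < +oo)%E ->
  exists2 I : R, 0 < I & forall (n : nat) (c : R), (0 < n)%N -> 0 < a n ->
    ('E_P[fun t => `|normalized_max X a n t|%R] < +oo)%E -> 0 <= c ->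
    (forall x, `|F (a n * x) ^+ n - frechet_cdf alpha x| <=
      c * (frechet_envelope alpha x + `|F (a m * x) ^+ m - (0 <= x)%R%:R|)) ->
    (wasserstein1 (distribution P (normalized_max X a n)) (frechet alpha_gt0)
      <= (I * c)%:E)%E.
Proof.
move=> indep XF m0 am0 al1 Zm.
have [ndF _ _ _] := cdfP (XF 0%N).
pose e x := frechet_envelope alpha x + `|F (a m * x) ^+ m - (0 <= x)%R%:R|.
have e0 x : 0 <= e x by rewrite addr_ge0// frechet_envelope_ge0.
have me1 : measurable_fun setT (frechet_envelope alpha).
  exact: measurable_frechet_envelope.
have me2 : measurable_fun setT (fun x : R => `|F (a m * x) ^+ m - (0 <= x)%R%:R|).
  apply: measurableT_comp => //; apply: measurable_funB.
    exact: measurable_cdf_power.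
  exact: measurable_ge0_indic.
have me : measurable_fun setT e by exact: measurable_funD.
have eoo : (\int[lebesgue_measure]_x (e x)%:E < +oo)%E.
  under eq_integral do rewrite EFinD.
  rewrite ge0_integralD//=; last 3 first.
  - by move=> x _; rewrite lee_fin frechet_envelope_ge0.
  - exact/measurable_EFinP.
  - exact/measurable_EFinP.
  apply: lte_add_pinfty; first exact: integral_frechet_envelope.
  exact: (integral_abs_max_cdf indep XF).
have ie0 : (0 <= \int[lebesgue_measure]_x (e x)%:E)%E.
  by apply: integral_ge0 => x _; rewrite lee_fin.
pose I := fine (\int[lebesgue_measure]_x (e x)%:E).
have IE : (\int[lebesgue_measure]_x (e x)%:E = I%:E)%E.
  by rewrite fineK// ge0_fin_numE.
have I0 : 0 <= I by rewrite -lee_fin -IE.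
(* Adding 1 makes the constant positive. *)
exists (I + 1); first by rewrite ltr_wpDl.
move=> n c n0 an0 Zn c0 H.
apply: (le_trans (wasserstein1_max_le _ indep XF n0 an0 Zn)).
apply: (@le_trans _ _ (\int[lebesgue_measure]_x (c%:E * (e x)%:E))%E).
  apply: ge0_le_integral => //.
  - apply/measurable_EFinP; apply: measurableT_comp => //.
    apply: measurable_funB; first exact: measurable_cdf_power.
    apply: nondecreasing_measurable => //.
    exact: frechet_cdf_nondecreasing.
  - by apply: measurable_funeM; exact/measurable_EFinP.
  - by move=> x _; rewrite -EFinM lee_fin; exact: H.
rewrite ge0_integralZl//; last 2 first.
- exact/measurable_EFinP.
- by move=> x _; rewrite lee_fin.
by rewrite IE -EFinM lee_fin mulrC ler_wpM2r// lerDl.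
Qed.


Lemma max_frechet_rate d (T : measurableType d) (R : realType)
    (P : probability T R) (X : nat -> {RV P >-> R}) (F : R -> R)
    (alpha rho ell : R) (L A : R -> R) (alpha_gt0 : 0 < alpha) :
  1 < alpha -> rho < 0 ->
  mutually_independent X -> (forall i x, cdf (X i) x = (F x)%:E) -> 0 < ell ->
  (forall x, 0 < x -> 1 - F x = ell * x `^ (- alpha) * L x) ->
  L t @[t --> +oo] --> (1 : R) ->
  (forall t, 0 < t -> A t = - rho * (1 - L t) / L t) ->
  second_order_regularly_varying (- alpha) rho A (fun x => 1 - F x) ->
  let a := fun n : nat => quantile F (1 - n%:R^-1) in
  exists (C : R) (N : nat), 0 < C /\
    forall n : nat, (2 <= n)%N -> 0 < a n ->
      ('E_P[fun t => `|normalized_max X a n t|%R] < +oo)%E -> (N <= n)%N ->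
      n%:R^-1 + `|A (a n)| <= 1 /\
      (wasserstein1 (distribution P (normalized_max X a n)) (frechet alpha_gt0)
        <= (C * (n%:R^-1 + `|A (a n)|))%:E)%E.
Proof.
move=> al1 rho0 indep XF ell0 tailF L1 AE RV2 a.
(* Either no index is admissible and the claim is vacuous, or one such [m] is fixed to dominate the
   left tail of all later maxima. *)
have [[m [m2 am0 Zm]]|none] := pselect (exists m : nat, [/\ (2 <= m)%N, 0 < a m &
    ('E_P[fun t => `|normalized_max X a m t|%R] < +oo)%E]); last first.
  exists 1, 0%N; split => // n n2 an0 Zn _.
  by exfalso; apply: none; exists n.
have [ndF rcF F0 F1] := cdfP (XF 0%N).
have F_ge0 x : 0 <= F x by rewrite -lee_fin -(XF 0%N) cdf_ge0.
have L_gt0 : \forall t \near +oo, 0 < L t by apply: (cvgr_gt _ L1).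
have F_lt1 x : F x < 1.
  near (@pinfty_nbhs R) => t.
  apply: (@le_lt_trans _ _ (F t)).
    by apply: ndF; near: t; apply: nbhs_pinfty_ge; exact: num_real.
  have t0 : 0 < t by near: t; apply: nbhs_pinfty_gt; exact: num_real.
  have Lt : 0 < L t by near: t.
  by rewrite -subr_gt0 tailF// !mulr_gt0// powR_gt0.
have inv01 n : (2 <= n)%N -> 0 < (1 - n%:R^-1 : R) < 1.
  move=> n2; have n0 : 0 < n%:R :> R by rewrite ltr0n (leq_trans _ n2).
  rewrite subr_gt0 invf_lt1// ltr1n n2/= ltrBlDr ltrDl invr_gt0//.
have a_le n x : (2 <= n)%N -> (a n <= x) = (1 - n%:R^-1 <= F x).
  by move=> n2; rewrite /a quantile_le// inv01.
have Fa n : (2 <= n)%N -> 1 - F (a n) <= n%:R^-1.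
  by move=> n2; have := lexx (a n); rewrite a_le//; lra.
have Fs n s : (2 <= n)%N -> s < a n -> n%:R^-1 <= 1 - F s.
  by move=> n2; rewrite ltNge a_le// -ltNge; lra.
have a_mono n p : (2 <= n)%N -> (n <= p)%N -> a n <= a p.
  move=> n2 np; have p2 := leq_trans n2 np.
  rewrite a_le//; have := Fa p p2.
  have : p%:R^-1 <= n%:R^-1 :> R.
    by rewrite lef_pV2 ?posrE ?ltr0n ?ler_nat// (leq_trans _ n2, leq_trans _ p2).
  by lra.
have a_unbounded M : exists N, forall n, (2 <= n)%N -> (N <= n)%N -> M <= a n.
  have FM : 0 < 1 - F M by rewrite subr_gt0.
  exists (Num.truncn (1 - F M)^-1).+1 => n n2 Nn.
  apply/ltW; rewrite ltNge a_le// -ltNge ltrBrDl -ltrBrDr.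
  rewrite -[ltRHS]invrK ltf_pV2 ?posrE ?invr_gt0 ?ltr0n ?(leq_trans _ n2)//.
  by rewrite (lt_le_trans (truncnS_gt _))// ler_nat.
have [K [k [K0 HK]]] :=
  second_order_tail_potter alpha_gt0 rho0 ell0 ndF tailF L1 AE RV2.
have [C1 C10 HC1] := frechet_max_approx alpha_gt0 ell0 ndF F_ge0 tailF L1 K0 HK.
(* [|1 - L| = |A| L / |rho|], and [L <= 2] far out. *)
pose cA := 2 / `|rho|.
have nrho : 0 < `|rho| by rewrite normr_gt0 lt_eqF.
have cA0 : 0 < cA by rewrite divr_gt0.
have A_small : \forall t \near +oo, `|A t| <= 2^-1 /\ `|1 - L t| <= cA * `|A t|.
  (* The first bound keeps [L] between 1/2 and 2; together with the second it gives [|A| <= 1/2]. *)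
  have e0 : 0 < Num.min 2^-1 (4 * `|rho|)^-1.
    by rewrite lt_min !invr_gt0 ltr0n/= mulr_gt0.
  near=> t.
  have : `|1 - L t| <= Num.min 2^-1 (4 * `|rho|)^-1.
    by near: t; move/cvgrPdist_le : L1; apply.
  rewrite le_min => /andP[D2 D4].
  have t0 : 0 < t by near: t; apply: nbhs_pinfty_gt; exact: num_real.
  have [Llo Lhi] : 2^-1 <= L t /\ L t <= 2 by move: D2; rewrite ler_norml; lra.
  have Lt0 : 0 < L t by lra.
  rewrite AE// normrM normfV normrM normrN (gtr0_norm Lt0); split.
    rewrite ler_pdivrMr//; apply: (@le_trans _ _ 4^-1); last by lra.
    by move: D4; rewrite -[_^-1]mul1r ler_pdivlMr ?mulr_gt0//; lra.
  have -> : cA * (`|rho| * `|1 - L t| / L t) = `|1 - L t| * (2 / L t).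
    by rewrite /cA; field; rewrite !gt_eqF.
  by rewrite ler_peMr// ler_pdivlMr// mul1r.
have [M [_ HM]] : \forall t \near +oo,
    (`|A t| <= 2^-1 /\ `|1 - L t| <= cA * `|A t|) /\
    (forall n : nat, (0 < n)%N ->
      1 - F t <= n%:R^-1 -> (forall s, s < t -> n%:R^-1 <= 1 - F s) ->
      forall x, 0 < x ->
      `|F (t * x) ^+ n - expR (- x `^ (- alpha))| <=
        C1 * (n%:R^-1 + `|1 - L t|) * Num.min 1 (x `^ (- alpha))).
  by near=> t; split; near: t.
have [N HN] := a_unbounded (M + 1).
have [I I0 HI] := wasserstein1_max_le_envelope alpha_gt0 indep XF
  (ltnW m2) am0 al1 Zm.
have F001 : 0 <= F 0 < 1 by rewrite F_ge0 F_lt1.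
have [K2 K20 HK2] := expr_le_inv F001.
(* The first summand serves [x > 0], the second [x < 0], where its factor 2 comes from
   [n - m >= n / 2]; hence [m.*2] in the threshold. *)
pose c := C1 * (1 + cA) + 2 * K2.
have c0 : 0 < c by rewrite /c addr_gt0// mulr_gt0// addr_gt0.
exists (I * c), (maxn N m.*2); split; first exact: mulr_gt0.
move=> n n2 an0 Zn; rewrite geq_max => /andP[Nn mn].
have Man : M < a n by have := HN n n2 Nn; clear; lra.
have [[A2 DA] approx] := HM _ Man.
have n0 := ltnW n2.
have n0' : 0 < n%:R :> R by rewrite ltr0n.
set r := n%:R^-1 + _.
have r0 : 0 < r by rewrite ltr_pwDl// invr_gt0.
have nr : n%:R^-1 <= r by rewrite lerDl.
split.
  have : n%:R^-1 <= 2^-1 :> R by rewrite lef_pV2 ?posrE// ler_nat.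
  by rewrite /r; clear -A2; lra.
rewrite -mulrA; apply: HI => //; first by rewrite mulr_ge0// ltW.
move=> x; have E0 := frechet_envelope_ge0 alpha x.
set h := `|F (a m * x) ^+ m - _|.
have h0 : 0 <= h := normr_ge0 _.
have [x0|x0|x0] := ltgtP x 0.
- rewrite /frechet_cdf ltNge (ltW x0)/= subr0 ger0_norm ?exprn_ge0//.
  have mln : (m <= n)%N by rewrite (leq_trans _ mn)// -addnn leq_addr.
  have hE : h = F (a m * x) ^+ m.
    by rewrite /h leNgt x0 subr0 ger0_norm// exprn_ge0.
  (* For [x < 0] and [a m <= a n], [m] of the [n] factors are at most [F (a m * x)] and the others
     at most [F 0 < 1], which gives the decay in [n]. *)
  apply: (@le_trans _ _ (h * F 0 ^+ (n - m))).
    rewrite hE -[X in _ ^+ X <= _](subnKC mln) exprD; apply: ler_pM; rewrite ?exprn_ge0//.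
      apply: lerXn2r; rewrite ?nnegrE//; apply: ndF.
      by rewrite ler_wnM2r ?a_mono// ltW.
    apply: lerXn2r; rewrite ?nnegrE//; apply: ndF.
    by rewrite mulr_ge0_le0// ltW.
  have nm0 : (0 < n - m)%N.
    by rewrite subn_gt0 (leq_trans _ mn)// -addnn -addn1 leq_add2l ltnW.
  have Fnm : F 0 ^+ (n - m) <= 2 * K2 * r.
    apply: (le_trans (HK2 _ nm0)); rewrite ler_pdivrMr ?ltr0n//.
    have nmn : n%:R <= 2 * (n - m)%:R :> R.
      rewrite -natrM ler_nat mulnBr mul2n mul2n -addnn.
      by rewrite -addnBA// leq_addr.
    have rn : 1 <= r * n%:R by rewrite -ler_pdivrMr// div1r.
    have rnm : 1 <= r * (2 * (n - m)%:R).
      by rewrite (le_trans rn)// ler_pM2l.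
    rewrite -[X in X <= _]mulr1.
    have -> : 2 * K2 * r * (n - m)%:R = K2 * (r * (2 * (n - m)%:R)) by ring.
    by rewrite ler_pM2l.
  rewrite mulrC -subr_ge0.
  have -> : c * r * (frechet_envelope alpha x + h) - F 0 ^+ (n - m) * h =
    c * r * frechet_envelope alpha x + C1 * (1 + cA) * r * h +
    (2 * K2 * r - F 0 ^+ (n - m)) * h.
    by rewrite /c; ring.
  rewrite !addr_ge0// ?mulr_ge0// ?subr_ge0// ?(ltW c0) ?(ltW r0) ?(ltW C10)//.
  by rewrite addr_ge0// ltW.
- rewrite /frechet_cdf x0.
  apply: (le_trans (approx n n0 (Fa n n2) (fun s => Fs n s n2) x x0)).
  have env := frechet_envelope_min alpha (ltW x0).
  have min0 : 0 <= Num.min 1 (x `^ (- alpha)) by rewrite le_min ler01 powR_ge0.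
  apply: (@le_trans _ _ (C1 * ((1 + cA) * r) * frechet_envelope alpha x)).
    apply: ler_pM => //.
      by rewrite mulr_ge0 ?(ltW C10)// addr_ge0// invr_ge0 ltW.
    rewrite ler_pM2l// /r.
    have : 0 <= cA * n%:R^-1 by rewrite mulr_ge0 ?(ltW cA0)// invr_ge0 ltW.
    by have := normr_ge0 (A (a n)); clear -DA; lra.
  rewrite -subr_ge0.
  have -> : c * r * (frechet_envelope alpha x + h) -
      C1 * ((1 + cA) * r) * frechet_envelope alpha x =
      2 * K2 * r * frechet_envelope alpha x + c * r * h by rewrite /c; ring.
  by rewrite addr_ge0// !mulr_ge0// ltW.
- rewrite x0 mulr0 /frechet_cdf ltxx subr0 ger0_norm ?exprn_ge0//.
  have E1 : 1 <= frechet_envelope alpha 0.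
    by apply: frechet_envelope_ge1; rewrite lexx ler01.
  apply: (le_trans (HK2 n n0)).
  apply: (@le_trans _ _ (c * r * 1)).
    rewrite mulr1; apply: ler_pM => //; rewrite ?invr_ge0 ?(ltW K20) ?(ltW n0')//.
    have : 0 < C1 * (1 + cA) by rewrite mulr_gt0// addr_gt0.
    by rewrite /c; clear -K20; lra.
  rewrite ler_wpM2l ?mulr_ge0 ?(ltW c0) ?(ltW r0)//.
  by rewrite -x0 in E1 *; clear -E1 h0; lra.
Unshelve. all: by end_near. Qed.

Theorem corollary3p2 (R : realType) (alpha rho : R)
  (alpha_gt1 : 1 < alpha) (rho_lt0 : rho < 0)
  (d : measure_display) (T : measurableType d) (P : probability T R)
  (X : nat -> {RV P >-> R})
  (X_indep : mutually_independent X)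
  (F : R -> R) (X_cdf : forall i x, cdf (X i) x = (F x)%:E)
  (ell : R) (L A : R -> R)
  (ell_gt0 : 0 < ell)
  (tail_ell_L : forall x, 0 < x -> 1 - F x = ell * x `^ (- alpha) * L x)
  (L_to_1 : L t @[t --> +oo] --> (1 : R))
  (A_def : forall t, 0 < t -> A t = - rho * (1 - L t) / L t)
  (tail_2RV :
    second_order_regularly_varying (- alpha) rho A (fun x => 1 - F x)) :
  let a := fun n : nat => quantile F (1 - n%:R^-1) in
  let Z := normalized_max X a in
  let alpha_gt0 := lt_trans ltr01 alpha_gt1 in
  (continuous F ->
    exists2 C : R, 0 < C &
      forall n : nat, (2 <= n)%N -> 0 < a n ->
        ('E_P[fun t => `|Z n t|%R] < +oo)%E ->
        (wasserstein1 (distribution P (Z n)) (frechet alpha_gt0) <=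
          (C * (n%:R^-1 + `|A (a n)|))%:E)%E) /\
  (~ continuous F ->
    forall delta : R, 1 < delta -> delta < alpha ->
      exists2 C : R, 0 < C &
        forall n : nat, (2 <= n)%N -> 0 < a n ->
          ('E_P[fun t => `|Z n t|%R] < +oo)%E ->
          (wasserstein1 (distribution P (Z n)) (frechet alpha_gt0) <=
            (C * (n%:R^-1 + `|A (a n)|) `^ (1 - delta^-1))%:E)%E).
Proof.
move=> a Z alpha_gt0.
have [C [N [C0 rate]]] := max_frechet_rate alpha_gt0 alpha_gt1 rho_lt0 X_indep
  X_cdf ell_gt0 tail_ell_L L_to_1 A_def tail_2RV.
pose Q n := [/\ (2 <= n)%N, 0 < a n & ('E_P[fun t => `|Z n t|%R] < +oo)%E].
pose r n : R := n%:R^-1 + `|A (a n)|.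
pose W n := wasserstein1 (distribution P (Z n)) (frechet alpha_gt0).
have r_gt0 n : Q n -> 0 < r n.
  by case=> n2 _ _; rewrite ltr_pwDl// invr_gt0 ltr0n ltnW.
have W_lty n : Q n -> (W n < +oo)%E.
  move=> [n2 an0 Zn].
  exact: (wasserstein1_max_lty _ X_indep X_cdf (ltnW n2) an0 alpha_gt1 Zn).
split=> [_|_ delta d1 _].
  have rW n : (N <= n)%N -> Q n -> (W n <= (C * r n)%:E)%E.
    by move=> Nn [n2 an0 Zn]; have [] := rate n n2 an0 Zn Nn.
  (* The finitely many [n] below [N] are absorbed into the constant. *)
  have [C' C'0 HC'] := finite_patch C0 r_gt0 W_lty rW.
  by exists C' => // n n2 an0 Zn; apply: HC'.
have rd_gt0 n : Q n -> 0 < r n `^ (1 - delta^-1).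
  by move=> /r_gt0 /powR_gt0; exact.
have rd n : (N <= n)%N -> Q n -> (W n <= (C * r n `^ (1 - delta^-1))%:E)%E.
  move=> Nn Qn; have rn0 := r_gt0 n Qn; case: Qn => n2 an0 Zn.
  have [r1 Wn] := rate n n2 an0 Zn Nn.
  apply: (le_trans Wn); rewrite lee_fin ler_pM2l//.
  (* As [r n <= 1], an exponent at most 1 does not decrease it. *)
  apply: ger1_powR; first by rewrite rn0.
  by rewrite gerBl invr_ge0 ltW// (lt_trans ltr01).
have [C' C'0 HC'] := finite_patch C0 rd_gt0 W_lty rd.
by exists C' => // n n2 an0 Zn; apply: HC'.
Qed.
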